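(* Assume the Setting and consider Algorithm 1 with $0\le\beta<1$, and $\tau>1$, $\mu_0>0$ chosen such that $1-\frac{1+\eta}{\tau}-\eta-\frac{\mu_0}{4\sigma}>0$; let $n_\delta$ denote the stopping index for data $y^\delta$. Then there exists a solution $x^*$ of $F(x)=y$ with $x^*\in B_{2\rho}(x_0)\cap\mathrm{dom}(\mathcal R)$ such that for every sequence $\delta_l\to0$, $\delta_l>0$, and every choice of data $y^{\delta_l}$ with $\|y^{\delta_l}-y\|\le\delta_l$, one has $\lim_{l\to\infty}D_{\mathcal R}^{\xi_{n_{\delta_l}}^{\delta_l}}(x^*,x_{n_{\delta_l}}^{\delta_l})=0$ and $\lim_{l\to\infty}\|x_{n_{\delta_l}}^{\delta_l}-x^*\|=0$. (Here $x^*$ is the strong limit of the exact-data iterates $x_n$ of Algorithm 2 with the same parameters.) If in addition $\mathrm{Ker}(L(x^\dagger))\subset\mathrm{Ker}(L(x))$ for all $x\in B_{2\rho}(x_0)$, then $x^*=x^\dagger$.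
   Context: Setting. Let $X,Y$ be real Hilbert spaces. Let $\mathcal R:X\to(-\infty,\infty]$ be proper, lower semicontinuous and strongly convex with constant $\sigma>0$, i.e. $\mathcal R(t\bar x+(1-t)x)+\sigma t(1-t)\|\bar x-x\|^2\le t\mathcal R(\bar x)+(1-t)\mathcal R(x)$ for all $\bar x,x\in\mathrm{dom}(\mathcal R)$ and $t\in[0,1]$. For $\xi\in\partial\mathcal R(x)$ (subdifferential) the Bregman distance is $D_{\mathcal R}^{\xi}(z,x)=\mathcal R(z)-\mathcal R(x)-\langle\xi,z-x\rangle$. The convex conjugate $\mathcal R^*$ is differentiable with $\|\nabla\mathcal R^*(\bar\xi)-\nabla\mathcal R^*(\xi)\|\le\|\bar\xi-\xi\|/(2\sigma)$, and $\nabla\mathcal R^*(\xi)=\arg\min_{x\in X}\{\mathcal R(x)-\langle\xi,x\rangle\}$ (unique minimizer), with $\xi\in\partial\mathcal R(\nabla\mathcal R^*(\xi))$. Let $F:\mathrm{dom}(F)\subset X\to Y$ and $y\in Y$. Assume: (b) there are $\rho>0$, $x_0\in X$, $\xi_0\in\partial\mathcal R(x_0)$ with $B_{2\rho}(x_0):=\{x:\|x-x_0\|\le 2\rho\}\subset\mathrm{dom}(F)$, and $F(x)=y$ has a solution $\bar x$ with $D_{\mathcal R}^{\xi_0}(\bar x,x_0)\le\sigma\rho^2$; (c) $F$ is weakly closed: if $x_n\in\mathrm{dom}(F)$, $x_n\rightharpoonup x$ and $F(x_n)\to v$, then $x\in\mathrm{dom}(F)$ and $F(x)=v$; (d) there are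 bounded linear operators $L(x):X\to Y$, $x\in B_{2\rho}(x_0)$, with $x\mapsto L(x)$ continuous on $B_{2\rho}(x_0)$, a constant $\eta\in[0,1)$ with $\|F(x)-F(\bar x)-L(\bar x)(x-\bar x)\|\le\eta\|F(x)-F(\bar x)\|$ for all $x,\bar x\in B_{2\rho}(x_0)$, and a constant $L>0$ with $\|L(x)\|\le L$ on $B_{2\rho}(x_0)$. Under these assumptions $F(x)=y$ has a unique solution $x^\dagger\in\mathrm{dom}(F)$ minimizing $D_{\mathcal R}^{\xi_0}(x,x_0)$ over all solutions; it satisfies $\|x^\dagger-x_0\|\le\rho$. Algorithm 1 (noisy data $y^\delta$ with $\|y^\delta-y\|\le\delta$, $\delta>0$). Parameters: $\tau>1$, $\beta\in[0,\infty]$, $\mu_0>0$, $\mu_1>0$, and a fixed choice of one of two step-size rules: (constant) $\alpha_n^\delta=\mu_0/L^2$, or (adaptive) $\alpha_n^\delta=\min\{\mu_0\|r_n^\delta\|^2/\|g_n^\delta\|^2,\mu_1\}$ (with $\mu_0\|r_n^\delta\|^2/\|g_n^\delta\|^2:=+\infty$ if $g_n^\delta=0$). Set $\xi_{-1}^\delta=\xi_0^\delta=\xi_0$, $x_0^\delta=x_0=\nabla\mathcal R^*(\xi_0)$. For $n\ge0$: (i) $r_n^\delta:=F(x_n^\delta)-y^\delta$; if $\|r_n^\delta\|\le\tau\delta$, stop and output $x_n^\delta$ (the stopping index is denoted $n_\delta$; it is finite under the hypotheses of the claim). (ii) $g_n^\delta:=L(x_n^\delta)^*r_n^\delta$ and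 $\alpha_n^\delta$ by the chosen rule. (iii) $m_n^\delta:=\xi_n^\delta-\xi_{n-1}^\delta$; $\tilde\gamma_0^\delta:=0$ and for $n\ge1$, $\tilde\gamma_n^\delta:=\langle m_n^\delta,x_n^\delta-x_{n-1}^\delta\rangle-(1-\eta)\alpha_{n-1}^\delta\|r_{n-1}^\delta\|^2+(1+\eta)\alpha_{n-1}^\delta\delta\|r_{n-1}^\delta\|+\beta_{n-1}^\delta\tilde\gamma_{n-1}^\delta$. (iv) $\beta_n^\delta:=\min\{\max\{0,(\alpha_n^\delta\langle g_n^\delta,m_n^\delta\rangle-2\sigma\tilde\gamma_n^\delta)/\|m_n^\delta\|^2\},\beta\}$ if $m_n^\delta\ne0$, and $\beta_n^\delta:=0$ if $m_n^\delta=0$. (v) $\xi_{n+1}^\delta:=\xi_n^\delta-\alpha_n^\delta g_n^\delta+\beta_n^\delta m_n^\delta$, $x_{n+1}^\delta:=\nabla\mathcal R^*(\xi_{n+1}^\delta)$. Algorithm 2 (exact data $y$). Same parameters $\beta,\mu_0,\mu_1$ and same step-size rule type: (constant) $\alpha_n=\mu_0/L^2$, or (adaptive) $\alpha_n=\min\{\mu_0\|r_n\|^2/\|g_n\|^2,\mu_1\}$ if $r_n\ne0$ and $\alpha_n=0$ if $r_n=0$. Set $\xi_{-1}=\xi_0$, $x_0=\nabla\mathcal R^*(\xi_0)$. For all $n\ge0$ (no stopping): $r_n:=F(x_n)-y$, $g_n:=L(x_n)^*r_n$, $\alpha_n$ by the rule; $m_n:=\xi_n-\xi_{n-1}$; $\tilde\gamma_0:=0$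 and for $n\ge1$, $\tilde\gamma_n:=\langle m_n,x_n-x_{n-1}\rangle-(1-\eta)\alpha_{n-1}\|r_{n-1}\|^2+\beta_{n-1}\tilde\gamma_{n-1}$; $\beta_n:=\min\{\max\{0,(\alpha_n\langle g_n,m_n\rangle-2\sigma\tilde\gamma_n)/\|m_n\|^2\},\beta\}$ if $m_n\ne0$ and $\beta_n:=0$ if $m_n=0$; $\xi_{n+1}:=\xi_n-\alpha_ng_n+\beta_nm_n$, $x_{n+1}:=\nabla\mathcal R^*(\xi_{n+1})$. *)

(* Defs.v *)
From HB Require Import structures.
From mathcomp Require Import all_boot all_order all_algebra.
From mathcomp Require Import all_classical all_reals.
From mathcomp Require Import all_analysis.
Set Implicit Arguments. Unset Strict Implicit. Unset Printing Implicit Defensive.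
Import Order.TTheory GRing.Theory Num.Theory.
Import numFieldNormedType.Exports.
Local Open Scope classical_set_scope.
Local Open Scope ring_scope.

Section Hilbert.
Variables (R : realType) (V : lmodType R) (ip : V -> V -> R).

Definition ipnorm (x : V) : R := Num.sqrt (ip x x).

Definition strong_cvg (u : nat -> V) (l : V) : Prop :=
  (fun n => ipnorm (u n - l)) @ \oo --> (0 : R).

Definition weak_cvg (u : nat -> V) (l : V) : Prop :=
  forall z : V, (fun n => ip z (u n)) @ \oo --> ip z l.

Definition is_hilbert : Prop :=
  [/\ (forall x y, ip x y = ip y x),
      (forall (a : R) x y z, ip (a *: x + y) z = a * ip x z + ip y z),
      (forall x, 0 <= ip x x),
      (forall x, ip x x = 0 -> x = 0) &
      (forall u : nat -> V,
         (forall e : R, 0 < e -> exists N : nat, forall m n : nat,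
             (N <= m)%N -> (N <= n)%N -> ipnorm (u m - u n) < e) ->
         exists l, strong_cvg u l)].

Definition hball (c : V) (r : R) : set V := [set x | ipnorm (x - c) <= r].
End Hilbert.

Local Open Scope ereal_scope.
Section Convex.
Variables (R : realType) (X : lmodType R) (ip : X -> X -> R) (Rf : X -> \bar R).

Definition edom : set X := [set x | Rf x < +oo].

Definition proper_fun : Prop :=
  (exists x, Rf x < +oo) /\ (forall x, -oo < Rf x).

(* lower semicontinuity (w.r.t. the norm topology), via closedness of
   sublevel sets under strong sequential limits *)
Definition lsc_fun : Prop :=
  forall (u : nat -> X) (l : X) (t : R),
    strong_cvg ip u l -> (forall n, Rf (u n) <= t%:E) -> Rf l <= t%:E.

Definition strongly_convex (sigma : R) : Prop :=
  forall (xb x : X) (t : R), edom xb -> edom x -> (0 <= t <= 1)%R ->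
    Rf (t *: xb + (1 - t) *: x) + (sigma * t * (1 - t) * ipnorm ip (xb - x) ^+ 2)%:E
    <= t%:E * Rf xb + (1 - t)%:E * Rf x.

Definition subdiff (x : X) : set X :=
  [set xi | Rf x \is a fin_num /\
            forall z, Rf x + (ip xi (z - x))%:E <= Rf z].

Definition bregman (xi z x : X) : \bar R := Rf z - Rf x - (ip xi (z - x))%:E.

(* gR xi = argmin_x { Rf x - <xi, x> }  (= grad R^*(xi)), unique minimizer *)
Definition is_grad_conj (gR : X -> X) : Prop :=
  forall xi : X, Rf (gR xi) \is a fin_num /\
    forall x, x <> gR xi ->
      Rf (gR xi) - (ip xi (gR xi))%:E < Rf x - (ip xi x)%:E.
End Convex.
Local Close Scope ereal_scope.

Record alg_state (X : Type) (R : Type) := AlgState {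
  st_xi_prev : X;
  st_xi : X;
  st_gam : R }.

Section Algorithm.
Variables (R : realType) (X Y : lmodType R)
  (ipX : X -> X -> R) (ipY : Y -> Y -> R)
  (gR : X -> X) (F : X -> Y) (Lstar : X -> Y -> X)
  (eta sigma mu0 mu1 Lc beta : R)
  (adaptive : bool)
  (xi0 : X).

Notation nX := (ipnorm ipX).
Notation nY := (ipnorm ipY).

(* step size; [exact] selects the convention of Algorithm 2 for r = 0 *)
Definition step_size (exact : bool) (r : Y) (g : X) : R :=
  if ~~ adaptive then mu0 / Lc ^+ 2
  else if exact && (r == 0) then 0
  else if g == 0 then mu1
  else Num.min (mu0 * nY r ^+ 2 / nX g ^+ 2) mu1.

Definition alg_step (exact : bool) (yd : Y) (delta : R)
    (s : alg_state X R) : alg_state X R :=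
  let xim1 := st_xi_prev s in
  let xin := st_xi s in
  let gam := st_gam s in
  let xn := gR xin in
  let rn := F xn - yd in
  let gn := Lstar xn rn in
  let an := step_size exact rn gn in
  let mn := xin - xim1 in
  let bn := if mn == 0 then 0
            else Num.min (Num.max 0 ((an * ipX gn mn - 2 * sigma * gam) / nX mn ^+ 2))
                         beta in
  let xinew := xin - an *: gn + bn *: mn in
  let gamnew := ipX (xinew - xin) (gR xinew - xn)
                - (1 - eta) * an * nY rn ^+ 2
                + (1 + eta) * an * delta * nY rn + bn * gam in
  AlgState xin xinew gamnew.

Fixpoint alg_states (exact : bool) (yd : Y) (delta : R) (n : nat) : alg_state X R :=
  match n with
  | 0%N => AlgState xi0 xi0 0
  | n'.+1 => alg_step exact yd delta (alg_states exact yd delta n')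
  end.

Definition xi_noisy (yd : Y) (delta : R) (n : nat) : X :=
  st_xi (alg_states false yd delta n).
Definition x_noisy (yd : Y) (delta : R) (n : nat) : X := gR (xi_noisy yd delta n).
Definition res_noisy (yd : Y) (delta : R) (n : nat) : Y := F (x_noisy yd delta n) - yd.

Definition is_stopping_index (tau : R) (yd : Y) (delta : R) (n : nat) : Prop :=
  nY (res_noisy yd delta n) <= tau * delta /\
  forall m, (m < n)%N -> tau * delta < nY (res_noisy yd delta m).

Definition xi_exact (y : Y) (n : nat) : X := st_xi (alg_states true y 0 n).
Definition x_exact (y : Y) (n : nat) : X := gR (xi_exact y n).
End Algorithm.

(* Main.v *)
(* The inertia [beta_n] minimises an upper bound of the next Bregman distance to a
   solution, so each step decreases that distance by a multiple of
   [alpha_n * |r_n|^2] as long as the noise is dominated by the residual. This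
   keeps the iterates in the ball, makes [sum alpha_n * |r_n|^2] finite and
   forces the discrepancy principle to stop.

   For exact data and [beta < 1], the momentum [xi_(n+1) - xi_n] is a geometrically
   damped sum of the gradients, so its inner product with [x_k - x^] is bounded by
   a summable sequence whenever [|r_k|] is minimal among [|r_0|, ..., |r_k|].
   Along such record indices [k], [D^{xi_m}(x_k, x_m)] is at most [Phi m - Phi k]
   for a convergent nonincreasing [Phi]: the [x_k] form a Cauchy sequence, and lower
   semicontinuity gives [D^{xi_m}(x*, x_m) -> 0] for the full sequence.

   For noisy data, the iterates up to the first vanishing exact residual depend
   continuously on the data: there [g_n <> 0] and [xi_(n+1) <> xi_n], so the
   quotients in [alpha_n] and [beta_n] are harmless. Monotonicity of the noisy
   Bregman distance up to the stopping index then transfers the convergence.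

   Under the kernel condition [xi_n - xi_0] is orthogonal to [x* - x'] for the
   solution [x'] closest to [x_0], so [x*] is a minimiser as well; the tangential
   cone condition makes the midpoint a solution, and strong convexity gives
   [x* = x']. *)
Require Import Defs.
From HB Require Import structures.
From mathcomp Require Import all_boot all_order all_algebra.
From mathcomp Require Import all_classical all_reals.
From mathcomp Require Import all_analysis.
From mathcomp Require Import ring lra.
Set Implicit Arguments. Unset Strict Implicit. Unset Printing Implicit Defensive.
Import Order.TTheory GRing.Theory Num.Theory.
Import numFieldNormedType.Exports.
Local Open Scope classical_set_scope.
Local Open Scope ring_scope.

(** * Limits of real sequences *)

Section RealSequences.
Context {R : realType}.

Lemma cvg_min (u v : nat -> R) (a b : R) :
  u @ \oo --> a -> v @ \oo --> b ->
  (fun n => Num.min (u n) (v n)) @ \oo --> Num.min a b.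
Proof.
move=> ua vb; rewrite minr_absE.
rewrite (_ : (fun n => _) = (fun n => (u n + v n - `|u n - v n|) / 2)); last first.
  by apply/funext => n; rewrite minr_absE.
by apply: cvgM (cvg_cst _); apply: cvgB; [apply: cvgD | apply: cvg_norm; apply: cvgB].
Qed.

Lemma cvg_max (u v : nat -> R) (a b : R) :
  u @ \oo --> a -> v @ \oo --> b ->
  (fun n => Num.max (u n) (v n)) @ \oo --> Num.max a b.
Proof.
move=> ua vb; rewrite maxr_absE.
rewrite (_ : (fun n => _) = (fun n => (u n + v n + `|u n - v n|) / 2)); last first.
  by apply/funext => n; rewrite maxr_absE.
by apply: cvgM (cvg_cst _); apply: cvgD; [apply: cvgD | apply: cvg_norm; apply: cvgB].
Qed.

Lemma cvg0_dom (u v : nat -> R) :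
  (\forall n \near \oo, 0 <= u n <= v n) -> v @ \oo --> (0 : R) -> u @ \oo --> (0 : R).
Proof. by move=> uv v0; apply: (squeeze_cvgr uv) => //; exact: cvg_cst. Qed.

Lemma cvg0P_le (u : nat -> R) : (forall n, 0 <= u n) ->
  (forall e, 0 < e -> \forall n \near \oo, u n <= e) -> u @ \oo --> (0 : R).
Proof.
move=> u0 H; apply/cvgr0Pnorm_le => e e0.
by apply: filterS (H e e0) => n; rewrite ger0_norm.
Qed.

Lemma no_unbounded_decrease (a : nat -> R) (c : R) : 0 < c ->
  (forall n, 0 <= a n) -> (forall n, a n.+1 <= a n - c) -> False.
Proof.
move=> c0 a0 dec.
have lin n : a n <= a 0%N - n%:R * c.
  elim: n => [|n IH]; first by rewrite mul0r subr0.
  by apply: (le_trans (dec n)); rewrite -natr1; lra.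
have := lin (Num.bound (a 0%N / c)); have := a0 (Num.bound (a 0%N / c)).
move: (archi_boundP (divr_ge0 (a0 0%N) (ltW c0))).
by rewrite ltr_pdivrMr //; lra.
Qed.

End RealSequences.

(** * Inner product spaces *)

Section HilbertSpace.
Context {R : realType} {V : lmodType R} {ip : V -> V -> R}.
Hypothesis hV : is_hilbert ip.
Notation nm := (ipnorm ip).

Lemma ipC x y : ip x y = ip y x. Proof. by case: hV. Qed.
Lemma ipPl a x y z : ip (a *: x + y) z = a * ip x z + ip y z.
Proof. by case: hV. Qed.
Lemma ip_ge0 x : 0 <= ip x x. Proof. by case: hV. Qed.
Lemma ip_eq0 x : ip x x = 0 -> x = 0. Proof. by case: hV => _ _ _ + _; apply. Qed.

Lemma ipDl x y z : ip (x + y) z = ip x z + ip y z.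
Proof. by rewrite -[in LHS](scale1r x) ipPl mul1r. Qed.
Lemma ip0l z : ip 0 z = 0.
Proof. by apply: (addrI (ip 0 z)); rewrite -ipDl addr0 addr0. Qed.
Lemma ipZl a x z : ip (a *: x) z = a * ip x z.
Proof. by rewrite -[in LHS](addr0 (a *: x)) ipPl ip0l addr0. Qed.
Lemma ipNl x z : ip (- x) z = - ip x z.
Proof. by rewrite -scaleN1r ipZl mulN1r. Qed.
Lemma ipDr x y z : ip z (x + y) = ip z x + ip z y.
Proof. by rewrite ipC ipDl !(ipC z). Qed.
Lemma ip0r z : ip z 0 = 0. Proof. by rewrite ipC ip0l. Qed.
Lemma ipZr a x z : ip z (a *: x) = a * ip z x.
Proof. by rewrite ipC ipZl ipC. Qed.
Lemma ipNr x z : ip z (- x) = - ip z x.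
Proof. by rewrite ipC ipNl ipC. Qed.
Definition ipE := (ipDl, ipDr, ipNl, ipNr, ipZl, ipZr, ip0l, ip0r).

Lemma ip_normE x : ip x x = nm x ^+ 2.
Proof. by rewrite /ipnorm sqr_sqrtr // ip_ge0. Qed.
Lemma ipnorm_ge0 x : 0 <= nm x. Proof. exact: sqrtr_ge0. Qed.
Lemma ipnorm0 : nm 0 = 0. Proof. by rewrite /ipnorm ip0l sqrtr0. Qed.
Lemma ipnorm_eq0 x : (nm x == 0) = (x == 0).
Proof.
apply/eqP/eqP => [x0|->]; last exact: ipnorm0.
by apply: ip_eq0; rewrite ip_normE x0 expr0n.
Qed.
Lemma ipnorm_gt0 x : (0 < nm x) = (x != 0).
Proof. by rewrite lt_neqAle eq_sym ipnorm_eq0 ipnorm_ge0 andbT. Qed.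
Lemma ipnormN x : nm (- x) = nm x.
Proof. by rewrite /ipnorm ipNl ipNr opprK. Qed.
Lemma ipnormBC x y : nm (x - y) = nm (y - x).
Proof. by rewrite -ipnormN opprB. Qed.
Lemma ipnormZ a x : nm (a *: x) = `|a| * nm x.
Proof.
rewrite /ipnorm ipZl ipZr mulrA -expr2 sqrtrM ?sqr_ge0 //.
by rewrite sqrtr_sqr.
Qed.

Lemma ip_CS x y : `|ip x y| <= nm x * nm y.
Proof.
have key : ip x y ^+ 2 <= ip x x * ip y y.
  have [->|y0] := eqVneq y 0; first by rewrite !ipE expr0n mulr0.
  have yy : 0 < ip y y by rewrite ip_normE exprn_gt0 // ipnorm_gt0.
  have := ip_ge0 (ip y y *: x - ip x y *: y).
  rewrite !ipE (ipC y x) => h.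
  suff : 0 <= ip y y * (ip x x * ip y y - ip x y ^+ 2).
    by rewrite pmulr_rge0 // subr_ge0.
  by apply: (le_trans h); rewrite le_eqVlt; apply/orP; left; apply/eqP; ring.
rewrite -sqrtr_sqr /ipnorm -sqrtrM ?ip_ge0 //.
by rewrite ler_sqrt // mulr_ge0 ?ip_ge0.
Qed.

Lemma ip_le x y : ip x y <= nm x * nm y.
Proof. exact: le_trans (ler_norm _) (ip_CS x y). Qed.

Lemma ipnormD x y : nm (x + y) <= nm x + nm y.
Proof.
rewrite -(@ler_pXn2r _ 2) ?nnegrE ?addr_ge0 ?ipnorm_ge0 // -ip_normE !ipE (ipC y x) !ip_normE.
by have := ip_le x y; nra.
Qed.

Lemma ipnormB_le x y z : nm (x - z) <= nm (x - y) + nm (y - z).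
Proof. by rewrite -[x - z](subrKA y); exact: ipnormD. Qed.

Lemma ipnorm_dist x y : `|nm x - nm y| <= nm (x - y).
Proof.
have h1 := ipnormD (x - y) y; have h2 := ipnormD (y - x) x.
rewrite !subrK in h1 h2; rewrite (ipnormBC y) in h2.
by rewrite ler_norml; apply/andP; split; lra.
Qed.

Lemma ipnorm_sqrB_scaled (a b : R) x y :
  nm (b *: x - a *: y) ^+ 2 = b ^+ 2 * nm x ^+ 2 - 2 * a * b * ip y x + a ^+ 2 * nm y ^+ 2.
Proof. by rewrite -!ip_normE !ipE (ipC y x); ring. Qed.

Lemma strong_cvg_dom (u : nat -> V) l (v : nat -> R) :
  (\forall n \near \oo, nm (u n - l) <= v n) -> v @ \oo --> (0 : R) -> strong_cvg ip u l.
Proof.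
move=> uv v0; apply: cvg0_dom v0.
by apply: filterS uv => n ->; rewrite ipnorm_ge0.
Qed.

Lemma strong_cvg_cst x : strong_cvg ip (fun=> x) x.
Proof. by rewrite /strong_cvg subrr ipnorm0; exact: cvg_cst. Qed.

Lemma strong_cvgD u v x y : strong_cvg ip u x -> strong_cvg ip v y ->
  strong_cvg ip (fun n => u n + v n) (x + y).
Proof.
move=> ux vy; apply: (@strong_cvg_dom _ _ (fun n => nm (u n - x) + nm (v n - y))).
  by near=> n; rewrite opprD addrACA; exact: ipnormD.
by rewrite -[0]addr0; exact: cvgD.
Unshelve. all: by end_near. Qed.

Lemma strong_cvgN u x : strong_cvg ip u x -> strong_cvg ip (fun n => - u n) (- x).
Proof.
by rewrite /strong_cvg => ux; under eq_fun do rewrite -opprD ipnormN.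
Qed.

Lemma strong_cvgB u v x y : strong_cvg ip u x -> strong_cvg ip v y ->
  strong_cvg ip (fun n => u n - v n) (x - y).
Proof. by move=> ux vy; apply: strong_cvgD => //; exact: strong_cvgN. Qed.

Lemma cvg_ipnorm u x : strong_cvg ip u x -> (fun n => nm (u n)) @ \oo --> nm x.
Proof.
move=> ux; apply/cvgrPdistC_lt => e e0.
move/cvgr0Pnorm_lt: ux => /(_ e e0); apply: filterS => n.
rewrite ger0_norm ?ipnorm_ge0 //; exact: le_lt_trans (ipnorm_dist _ _).
Qed.

Lemma strong_cvgZ (a : nat -> R) u (b : R) x : a @ \oo --> b -> strong_cvg ip u x ->
  strong_cvg ip (fun n => a n *: u n) (b *: x).
Proof.
move=> ab ux; apply: (@strong_cvg_dom _ _
  (fun n => `|a n - b| * nm (u n) + `|b| * nm (u n - x))).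
  near=> n; rewrite -!ipnormZ; apply: le_trans (ipnormD _ _).
  by rewrite scalerBl scalerBr subrKA.
rewrite -[0](_ : `|b - b| * nm x + `|b| * 0 = 0); last first.
  by rewrite subrr normr0 mul0r mulr0 addr0.
apply: cvgD; apply: cvgM => //; try exact: cvg_cst; last exact: cvg_ipnorm.
by apply: cvg_norm; apply: cvgB => //; exact: cvg_cst.
Unshelve. all: by end_near. Qed.

Lemma cvg_ip u v x y : strong_cvg ip u x -> strong_cvg ip v y ->
  (fun n => ip (u n) (v n)) @ \oo --> ip x y.
Proof.
move=> ux vy.
have h : (fun n => nm (u n - x) * nm (v n) + nm x * nm (v n - y)) @ \oo --> (0 : R).
  rewrite -[0](_ : 0 * nm y + nm x * 0 = 0); last by rewrite mul0r mulr0 addr0.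
  by apply: cvgD; apply: cvgM => //; try exact: cvg_cst; exact: cvg_ipnorm.
apply/cvgrPdistC_lt => e e0; move/cvgr0Pnorm_lt: h => /(_ e e0); apply: filterS => n.
rewrite ger0_norm ?addr_ge0 ?mulr_ge0 ?ipnorm_ge0 //; apply: le_lt_trans.
have -> : ip (u n) (v n) - ip x y = ip (u n - x) (v n) + ip x (v n - y).
  by rewrite !ipE; ring.
by apply: (le_trans (ler_normD _ _)); apply: lerD; exact: ip_CS.
Qed.

Lemma strong_cvg_weak u x : strong_cvg ip u x -> weak_cvg ip u x.
Proof. by move=> ux z; apply: cvg_ip => //; exact: strong_cvg_cst. Qed.

Lemma strong_cvg_near_neq0 u x : strong_cvg ip u x -> x != 0 ->
  \forall n \near \oo, u n != 0.
Proof.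
move=> /cvg_ipnorm ux; rewrite -ipnorm_gt0 => x0.
by apply: filterS (cvgr_gt _ ux _ x0) => n; rewrite ipnorm_gt0.
Qed.

Lemma hball_strong_limit (u : nat -> V) x c r : (forall n, hball ip c r (u n)) ->
  strong_cvg ip u x -> hball ip c r x.
Proof.
move=> uc ux; have uxc : (fun n => nm (u n - c)) @ \oo --> nm (x - c).
  by apply: cvg_ipnorm; apply: strong_cvgB => //; exact: strong_cvg_cst.
by apply: (cvgr_to_le uxc); near=> n; exact: uc.
Unshelve. all: by end_near. Qed.

End HilbertSpace.

(** * Bregman distances of a strongly convex penalty *)

Section BregmanDistance.
Context {R : realType} {X : lmodType R} {ip : X -> X -> R} {Rf : X -> \bar R}
  {sigma : R} {gR : X -> X}.
Hypothesis hX : is_hilbert ip.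
Hypothesis hsigma : 0 < sigma.
Hypothesis hproper : proper_fun Rf.
Hypothesis hlsc : lsc_fun ip Rf.
Hypothesis hconv : strongly_convex ip Rf sigma.
Hypothesis hgR : is_grad_conj ip Rf gR.
Notation nm := (ipnorm ip).

(** [fine] sends infinite values to 0, so this real version of the penalty is faithful only on
    [edom]; hence the domain hypotheses below. *)
Definition penalty (P : X -> \bar R) (z : X) : R := fine (P z).
Notation f := (penalty Rf).

Lemma edomE {z} : edom Rf z -> Rf z = (f z)%:E.
Proof.
move=> zd; rewrite /penalty fineK // fin_real // zd andbT.
by case: hproper => _; apply.
Qed.

Lemma edom_gR xi : edom Rf (gR xi).
Proof. by case: (hgR xi) => + _; rewrite fin_numElt => /andP[]. Qed.

Lemma gR_min xi z : edom Rf z -> f (gR xi) - ip xi (gR xi) <= f z - ip xi z.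
Proof.
move=> zd; have [->//|/eqP zx] := eqVneq z (gR xi).
case: (hgR xi) => _ /(_ z zx); rewrite (edomE zd) (edomE (edom_gR xi)).
by rewrite -!EFinB lte_fin => /ltW.
Qed.

(** The subgradient inequality says that [x] minimises the penalty minus [ip xi], and the minimiser
    is unique. *)
Lemma gR_unique x xi : subdiff ip Rf x xi -> x = gR xi.
Proof.
move=> [xf sub]; apply: contrapT => /(proj2 (hgR xi)).
have xd : edom Rf x by move: xf; rewrite fin_numElt => /andP[].
have := sub (gR xi).
rewrite (edomE xd) (edomE (edom_gR xi)) -EFinD -!EFinB lee_fin lte_fin !(ipE hX).
by move=> h1 h2; lra.
Qed.

Lemma strongly_convex_penalty x z t : edom Rf x -> edom Rf z -> 0 <= t <= 1 ->
  edom Rf (t *: x + (1 - t) *: z) /\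
  f (t *: x + (1 - t) *: z) + sigma * t * (1 - t) * nm (x - z) ^+ 2
    <= t * f x + (1 - t) * f z.
Proof.
move=> xd zd t01; have := hconv xd zd t01.
rewrite (edomE xd) (edomE zd) -!EFinM -EFinD => h.
have wd : edom Rf (t *: x + (1 - t) *: z).
  rewrite /edom /= ltNge leye_eq; apply/eqP => wE.
  by move: h; rewrite wE addye // leye_eq.
by split=> //; move: h; rewrite (edomE wd) -EFinD lee_fin.
Qed.

(** The base point is tied to the subgradient as [gR xi], which makes the distance a function of the
    dual variable alone. *)
Definition bregR (xi z : X) : R := f z - f (gR xi) - ip xi (z - gR xi).

Lemma bregmanE xi z : edom Rf z -> bregman ip Rf xi z (gR xi) = (bregR xi z)%:E.
Proof. by move=> zd; rewrite /bregman (edomE zd) (edomE (edom_gR xi)) -!EFinB. Qed.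

Lemma edom_bregman xi z (a : R) : (bregman ip Rf xi z (gR xi) <= a%:E)%E -> edom Rf z.
Proof.
rewrite /bregman (edomE (edom_gR xi)) /edom /= ltey => h; apply/eqP => zE.
by move: h; rewrite zE.
Qed.

Lemma bregR_self xi : bregR xi (gR xi) = 0.
Proof. by rewrite /bregR !subrr (ip0r hX) subr0. Qed.

Lemma bregR_ge xi z : edom Rf z -> sigma * nm (z - gR xi) ^+ 2 <= bregR xi z.
Proof.
move=> zd; set x := gR xi; set B := sigma * _.
have B0 : 0 <= B by rewrite mulr_ge0 ?sqr_ge0 // ltW.
(* Minimality of [x] along the segment from [x] to [z], divided by [t]. *)
have seg t : 0 < t <= 1 -> (1 - t) * B <= bregR xi z.
  move=> /andP[t0 t1].
  have t01 : 0 <= t <= 1 by rewrite ltW.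
  have [wd wle] := strongly_convex_penalty zd (edom_gR xi) t01.
  have := gR_min xi wd; rewrite -/x in wle * => hmin.
  rewrite -(ler_pM2l t0) /bregR -/x.
  move: hmin wle; rewrite /B !(ipE hX) => hmin wle.
  nra.
(* Let [t] tend to 0: this [t] makes the loss [t * B] at most [e], and [B + 1] guards against
   division by zero. *)
apply/ler_addgt0Pr => e e0; pose t := Num.min 1 (e / (B + 1)).
have B1 : 0 < B + 1 by lra.
have t0 : 0 < t by rewrite lt_min ltr01 divr_gt0.
have t1 : t <= 1 by rewrite ge_min lexx.
have tB : t * (B + 1) <= e by rewrite -ler_pdivlMr // ge_min lexx orbT.
have /seg : 0 < t <= 1 by rewrite t0.
clearbody t; move=> h; nra.
Qed.

Lemma bregR_ge0 xi z : edom Rf z -> 0 <= bregR xi z.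
Proof.
by move=> /(bregR_ge xi); apply: le_trans; rewrite mulr_ge0 ?sqr_ge0 // ltW.
Qed.

(** Three-point identity, the source of every one-step estimate. *)
Lemma bregR_change xi' xi z :
  bregR xi' z = bregR xi z + bregR xi' (gR xi) + ip (xi' - xi) (gR xi - z).
Proof. by rewrite /bregR !(ipE hX); ring. Qed.

(** The two opposite distances add up to the inner product of the increments. Bounding one below by
    [bregR_ge] leaves [a * b - sigma * b ^+ 2], which is maximal at [b = a / (2 * sigma)]. *)
Lemma bregR_le xi' xi : bregR xi' (gR xi) <= nm (xi' - xi) ^+ 2 / (4 * sigma).
Proof.
set x := gR xi; set x' := gR xi'.
have sym : bregR xi' x + bregR xi x' = ip (xi' - xi) (x' - x).
  by rewrite /bregR -/x -/x' !(ipE hX); ring.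
have h1 := bregR_ge xi (edom_gR xi'); rewrite -/x -/x' in h1.
have h2 := ip_le hX (xi' - xi) (x' - x).
rewrite ler_pdivlMr ?mulr_gt0 //.
set a := nm (xi' - xi) in h2 *; set b := nm (x' - x) in h1 h2 *.
set D := bregR xi' x in sym *.
have hD : D <= a * b - sigma * b ^+ 2 by lra.
have sq : 0 <= (a - 2 * sigma * b) ^+ 2 by exact: sqr_ge0.
by move: hD; rewrite -(ler_pM2r hsigma); nra.
Qed.

(** Here both opposite distances are bounded below by [bregR_ge], and one factor of the primal
    increment cancels. *)
Lemma gR_lipschitz xi' xi : nm (gR xi' - gR xi) <= nm (xi' - xi) / (2 * sigma).
Proof.
set x := gR xi; set x' := gR xi'.
have sym : bregR xi' x + bregR xi x' = ip (xi' - xi) (x' - x).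
  by rewrite /bregR -/x -/x' !(ipE hX); ring.
have h1 := bregR_ge xi (edom_gR xi'); rewrite -/x -/x' in h1.
have h2 := bregR_ge xi' (edom_gR xi); rewrite -/x -/x' (ipnormBC hX) in h2.
have h3 := ip_le hX (xi' - xi) (x' - x).
rewrite ler_pdivlMr ?mulr_gt0 //.
have [->|b0] := eqVneq (nm (x' - x)) 0; first by rewrite mul0r ipnorm_ge0.
have b1 : 0 < nm (x' - x) by rewrite lt_neqAle eq_sym b0 ipnorm_ge0.
by rewrite -(ler_pM2l b1); nra.
Qed.

Lemma gR_continuous (u : nat -> X) xi : strong_cvg ip u xi ->
  strong_cvg ip (fun n => gR (u n)) (gR xi).
Proof.
move=> uxi; apply: (strong_cvg_dom (v := fun n => nm (u n - xi) / (2 * sigma))).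
  by near=> n; exact: gR_lipschitz.
by rewrite -(mul0r (2 * sigma)^-1); apply: cvgM => //; exact: cvg_cst.
Unshelve. all: by end_near. Qed.

Lemma bregR_continuous (u : nat -> X) xi z : strong_cvg ip u xi ->
  (fun n => bregR (u n) z) @ \oo --> bregR xi z.
Proof.
move=> uxi.
have d0 : strong_cvg ip (fun n => u n - xi) 0.
  by rewrite -(subrr xi); apply: strong_cvgB => //; exact: strong_cvg_cst.
have h0 : (fun n => bregR (u n) (gR xi)) @ \oo --> (0 : R).
  apply: (@cvg0_dom _ _ (fun n => nm (u n - xi) ^+ 2 / (4 * sigma))).
    near=> n; rewrite bregR_le bregR_ge0 //; exact: edom_gR.
  rewrite -[0](_ : 0 * 0 / (4 * sigma) = 0); last by rewrite !mul0r.
  by apply: cvgM (cvg_cst _); under eq_fun do rewrite expr2; apply: cvgM.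
have -> : (fun n => bregR (u n) z) =
    (fun n => bregR xi z + bregR (u n) (gR xi) + ip (u n - xi) (gR xi - z)).
  by apply/funext => n; exact: bregR_change.
rewrite -[X in _ --> X](_ : bregR xi z + 0 + ip 0 (gR xi - z) = _); last first.
  by rewrite (ip0l hX) !addr0.
apply: cvgD; first by apply: cvgD => //; exact: cvg_cst.
by apply: (cvg_ip hX) => //; exact: strong_cvg_cst.
Unshelve. all: by end_near. Qed.

Lemma strong_cvg_bregR (xi : nat -> X) z : edom Rf z ->
  (fun n => bregR (xi n) z) @ \oo --> (0 : R) -> strong_cvg ip (fun n => gR (xi n)) z.
Proof.
move=> zd D0; apply: cvg0P_le => [n|e e0]; first exact: ipnorm_ge0.
have e2 : 0 < sigma * e ^+ 2 by rewrite mulr_gt0 // exprn_gt0.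
apply: filterS (cvgr_lt _ D0 _ e2) => n /ltW.
move=> /(le_trans (bregR_ge (xi n) zd)); rewrite ler_pM2l //.
by rewrite ler_pXn2r ?nnegrE ?ipnorm_ge0 ?(ltW e0) // (ipnormBC hX).
Qed.

(** Lower semicontinuity concerns the penalty alone, at a fixed level. The linear term varies with
    [n], so it is replaced by its limit plus [e], and [e] is removed at the end. *)
Lemma bregR_lsc xi (u : nat -> X) x (c : R) : strong_cvg ip u x ->
  (forall n, edom Rf (u n)) -> (\forall n \near \oo, bregR xi (u n) <= c) ->
  edom Rf x /\ bregR xi x <= c.
Proof.
move=> ux ud [N _ uc].
pose T := c + f (gR xi) + ip xi (x - gR xi).
have ipcv : (fun n => ip xi (u n)) @ \oo --> ip xi x.
  by apply: (cvg_ip hX) => //; exact: strong_cvg_cst.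
have le_e e : 0 < e -> (Rf x <= (T + e)%:E)%E.
  move=> e0.
  have [N' _ hN'] : \forall n \near \oo, ip xi (u n) < ip xi x + e.
    by apply: (cvgr_lt _ ipcv); lra.
  (* [lsc_fun] asks for the bound at every index, hence the shift past [N] and [N']. *)
  apply: (hlsc (u := fun n => u (n + (N + N'))%N)).
    by rewrite /strong_cvg (cvg_shiftn (N + N') (fun n => nm (u n - x))).
  move=> n; rewrite (edomE (ud _)) lee_fin.
  have h1 : bregR xi (u (n + (N + N'))%N) <= c.
    by apply: uc; rewrite /= addnCA leq_addr.
  have h2 : ip xi (u (n + (N + N'))%N) < ip xi x + e.
    by apply: hN'; rewrite /= addnA leq_addl.
  rewrite /bregR /T in h1 *.
  by move: h1 h2; rewrite !(ipE hX); lra.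
have xd : edom Rf x by apply: le_lt_trans (le_e 1 ltr01) _; exact: ltry.
split=> //; suff : f x <= T by rewrite /T /bregR; lra.
apply/ler_addgt0Pr => e /le_e; by rewrite (edomE xd) lee_fin.
Qed.

End BregmanDistance.

(** * The adaptive heavy ball method *)

Section HeavyBall.
Context {R : realType} {X Y : lmodType R}.
Variables (ipX : X -> X -> R) (ipY : Y -> Y -> R).
Hypotheses (hX : is_hilbert ipX) (hY : is_hilbert ipY).
Variables (Rf : X -> \bar R) (sigma : R) (gR : X -> X).
Hypothesis hsigma : 0 < sigma.
Hypotheses (hproper : proper_fun Rf) (hlsc : lsc_fun ipX Rf).
Hypothesis hconv : strongly_convex ipX Rf sigma.
Hypothesis hgR : is_grad_conj ipX Rf gR.
Variables (F : X -> Y) (y : Y) (x0 xi0 : X) (rho : R).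
Notation B := (hball ipX x0 (2 * rho)).
Notation nX := (ipnorm ipX).
Notation nY := (ipnorm ipY).
Notation D := (@bregR _ _ ipX Rf gR).
Variables (L : X -> X -> Y) (Lstar : X -> Y -> X) (eta Lc : R).
Hypothesis hlin : forall x, B x ->
  forall (a : R) (h k : X), L x (a *: h + k) = a *: L x h + L x k.
Hypothesis hadj : forall x, B x ->
  forall (r : Y) (h : X), ipX (Lstar x r) h = ipY r (L x h).
Hypothesis hLcont : forall x, B x ->
  forall e : R, 0 < e -> exists d : R, 0 < d /\
    forall x', B x' -> nX (x' - x) < d ->
      forall h, nY (L x' h - L x h) <= e * nX h.
Hypothesis heta : 0 <= eta < 1.
Hypothesis htcc : forall x xb, B x -> B xb ->
  nY (F x - F xb - L xb (x - xb)) <= eta * nY (F x - F xb).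
Hypothesis hLc : 0 < Lc.
Hypothesis hLbound : forall x, B x -> forall h, nY (L x h) <= Lc * nX h.

(** * Linearisations, their adjoints and the tangential cone condition *)

Lemma LB x h k : B x -> L x (h - k) = L x h - L x k.
Proof. by move=> Bx; rewrite addrC -scaleN1r hlin // scaleN1r addrC. Qed.

Lemma Lstar_norm x r : B x -> nX (Lstar x r) <= Lc * nY r.
Proof.
move=> Bx; have [->|g0] := eqVneq (nX (Lstar x r)) 0.
  by rewrite mulr_ge0 ?ipnorm_ge0 // ltW.
have gp : 0 < nX (Lstar x r) by rewrite lt_neqAle eq_sym g0 ipnorm_ge0.
rewrite -(ler_pM2r gp) -expr2 -(ip_normE hX) hadj //.
apply: le_trans (ip_le hY _ _) _; rewrite mulrAC mulrC ler_wpM2r ?ipnorm_ge0 //.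
exact: hLbound.
Qed.

Lemma LstarB x r s : B x -> Lstar x (r - s) = Lstar x r - Lstar x s.
Proof.
move=> Bx; apply/eqP; rewrite -subr_eq0; apply/eqP; apply: (ip_eq0 hX).
by set d := (X in ipX X X); rewrite {1}/d !(ipE hX) !hadj // !(ipE hY); ring.
Qed.

(** Together with [residual_le_L]: the cone condition makes linear and nonlinear differences
    comparable, by the triangle inequality. *)
Lemma L_le_residual x z : B x -> B z -> nY (L x (z - x)) <= (1 + eta) * nY (F z - F x).
Proof.
move=> Bx Bz; have := htcc Bz Bx; set a := F z - F x; set l := L x _ => h.
have -> : l = a - (a - l) by rewrite opprB addrC subrK.
by have := ipnormD hY a (- (a - l)); rewrite (ipnormN hY); lra.
Qed.

Lemma L_eq0 x z : B x -> B z -> F z = F x -> L x (z - x) = 0.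
Proof.
move=> Bx Bz Fzx; apply/eqP; rewrite -(ipnorm_eq0 hY) eq_le ipnorm_ge0 andbT.
by apply: le_trans (L_le_residual Bx Bz) _; rewrite Fzx subrr (ipnorm0 hY) mulr0.
Qed.

Lemma residual_le_L x z : B x -> B z -> (1 - eta) * nY (F z - F x) <= nY (L x (z - x)).
Proof.
move=> Bx Bz; have := htcc Bz Bx; set a := F z - F x; set l := L x _ => h.
by have := ipnormD hY (a - l) l; rewrite subrK; lra.
Qed.

(** Continuity is derived: [residual_le_L] and the bound on [L] give a Lipschitz estimate with
    constant [Lc / (1 - eta)]. *)
Lemma F_continuous (u : nat -> X) x : B x -> (\forall n \near \oo, B (u n)) ->
  strong_cvg ipX u x -> strong_cvg ipY (fun n => F (u n)) (F x).
Proof.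
move=> Bx Bu ux; have /andP[e0 e1] := heta.
apply: (strong_cvg_dom (v := fun n => Lc / (1 - eta) * nX (u n - x))).
  apply: filterS Bu => n Bun; rewrite mulrAC ler_pdivlMr ?subr_gt0 // mulrC.
  exact: le_trans (residual_le_L Bx Bun) (hLbound Bx _).
by rewrite -(mulr0 (Lc / (1 - eta))); apply: cvgM => //; exact: cvg_cst.
Qed.

Lemma Lstar_diff_norm x x' r e : 0 <= e -> B x -> B x' ->
  (forall h, nY (L x' h - L x h) <= e * nX h) ->
  nX (Lstar x' r - Lstar x r) <= e * nY r.
Proof.
move=> e0 Bx Bx' hL; set g := _ - _.
have [->|g0] := eqVneq (nX g) 0; first by rewrite mulr_ge0 ?ipnorm_ge0.
have gp : 0 < nX g by rewrite lt_neqAle eq_sym g0 ipnorm_ge0.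
rewrite -(ler_pM2r gp) -expr2 -(ip_normE hX).
have -> : ipX g g = ipY r (L x' g - L x g).
  by rewrite {1}/g (ipDl hX) (ipNl hX) (hadj Bx') (hadj Bx) (ipDr hY) (ipNr hY).
by apply: le_trans (ip_le hY _ _) _; rewrite mulrAC mulrC ler_wpM2r ?ipnorm_ge0.
Qed.

Lemma Lstar_continuous (u : nat -> X) (r : nat -> Y) x s : B x ->
  (\forall n \near \oo, B (u n)) -> strong_cvg ipX u x -> strong_cvg ipY r s ->
  strong_cvg ipX (fun n => Lstar (u n) (r n)) (Lstar x s).
Proof.
move=> Bx Bu ux rs.
have h1 : strong_cvg ipX (fun n => Lstar (u n) s) (Lstar x s).
  apply: (cvg0P_le (u := fun n => nX (Lstar (u n) s - Lstar x s))) => [n|e e0].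
    exact: ipnorm_ge0.
  (* The [+ 1] allows [s = 0] in the quotient [e / (nY s + 1)]. *)
  have s1 : 0 < nY s + 1 by rewrite ltr_wpDl ?ipnorm_ge0.
  have [d [d0 hd]] := hLcont Bx (divr_gt0 e0 s1).
  have du : \forall n \near \oo, nX (u n - x) < d by apply: (cvgr_lt _ ux).
  near=> n.
  have Bun : B (u n) by near: n.
  have un : nX (u n - x) < d by near: n.
  apply: le_trans (Lstar_diff_norm _ _ Bx Bun (hd _ Bun un)) _.
    by rewrite divr_ge0 ?ltW.
  by rewrite mulrAC ler_pdivrMr // ler_pM2l // lerDl.
apply: (strong_cvg_dom (v := fun n => Lc * nY (r n - s) + nX (Lstar (u n) s - Lstar x s))).
  apply: filterS Bu => n Bun.
  apply: le_trans (ipnormB_le hX _ (Lstar (u n) s) _) _.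
  by rewrite lerD2r -LstarB // Lstar_norm.
rewrite -[0](_ : Lc * 0 + 0 = 0); last by rewrite mulr0 addr0.
by apply: cvgD => //; apply: cvgM => //; exact: cvg_cst.
Unshelve. all: by end_near. Qed.

(** Split [L x (x - xh)] into the residual, the data error and the linearisation error; the cone
    condition bounds the last by [eta] times the residual norm plus [delta]. *)
Lemma gradient_inner_bound x xh yd delta : B x -> B xh -> F xh = y ->
  nY (yd - y) <= delta ->
  - ipX (Lstar x (F x - yd)) (x - xh) <=
    - (1 - eta) * nY (F x - yd) ^+ 2 + (1 + eta) * delta * nY (F x - yd).
Proof.
move=> Bx Bxh Fxh hyd; have /andP[e0 _] := heta.
rewrite hadj //; set r := F x - yd.
have tc := htcc Bxh Bx; rewrite Fxh in tc.
set e := y - F x - L x (xh - x) in tc.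
have -> : L x (x - xh) = r + (yd - y) + e.
  have -> : L x (x - xh) = - L x (xh - x) by rewrite !LB // opprB.
  by rewrite /r /e subrKA [F x - y + _]addrA subrKA addrN add0r.
have rr : nY (y - F x) <= nY r + delta.
  rewrite (ipnormBC hY); apply: le_trans (ipnormB_le hY _ yd _) _.
  by rewrite lerD2l.
clearbody r e.
have := ip_le hY r (- (yd - y)); have := ip_le hY r (- e).
rewrite !(ipnormN hY) !(ipE hY) (ip_normE hY r) => h1 h2.
have n0 : 0 <= nY r := ipnorm_ge0 _.
have h3 : nY r * nY e <= nY r * (eta * (nY r + delta)).
  by rewrite ler_wpM2l //; apply: le_trans tc _; rewrite ler_wpM2l.
have h4 : nY r * nY (yd - y) <= nY r * delta by rewrite ler_wpM2l.
nra.
Qed.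

(** * Step size, momentum and inertia *)

Variables (mu0 mu1 beta tau : R) (adaptive : bool).
Hypotheses (hmu0 : 0 < mu0) (hmu1 : 0 < mu1) (hbeta : 0 <= beta < 1).

Definition residual (yd : Y) (s : alg_state X R) : Y := F (gR (st_xi s)) - yd.
Definition gradient yd s : X := Lstar (gR (st_xi s)) (residual yd s).
Definition stepsize exact yd s : R :=
  step_size ipX ipY mu0 mu1 Lc adaptive exact (residual yd s) (gradient yd s).
Definition momentum (s : alg_state X R) : X := st_xi s - st_xi_prev s.
Definition inertia exact yd s : R :=
  if momentum s == 0 then 0
  else Num.min (Num.max 0 ((stepsize exact yd s * ipX (gradient yd s) (momentum s)
                            - 2 * sigma * st_gam s) / nX (momentum s) ^+ 2)) beta.
Notation step := (alg_step ipX ipY gR F Lstar eta sigma mu0 mu1 Lc beta adaptive).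

Lemma step_xi exact yd delta s :
  st_xi (step exact yd delta s) = st_xi s - stepsize exact yd s *: gradient yd s
    + inertia exact yd s *: momentum s.
Proof. by []. Qed.

Lemma step_momentum exact yd delta s :
  momentum (step exact yd delta s) = inertia exact yd s *: momentum s
    - stepsize exact yd s *: gradient yd s.
Proof. by rewrite /momentum [in LHS]step_xi addrC addrA addrA addNr add0r addrC. Qed.

Lemma step_gam exact yd delta s :
  let s' := step exact yd delta s in
  st_gam s' = ipX (momentum s') (gR (st_xi s') - gR (st_xi s))
    - (1 - eta) * stepsize exact yd s * nY (residual yd s) ^+ 2
    + (1 + eta) * stepsize exact yd s * delta * nY (residual yd s)
    + inertia exact yd s * st_gam s.
Proof. by []. Qed.

Lemma stepsize_ge0 exact yd s : 0 <= stepsize exact yd s.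
Proof.
rewrite /stepsize /step_size; case: ifP => _; first by rewrite divr_ge0 ?sqr_ge0 // ltW.
case: ifP => // _; case: ifP => [_|_]; first exact: ltW.
by rewrite le_min (ltW hmu1) andbT divr_ge0 ?sqr_ge0 // mulr_ge0 ?sqr_ge0 // ltW.
Qed.

Definition stepsize_lb : R := Num.min (mu0 / Lc ^+ 2) mu1.

Lemma stepsize_lb_gt0 : 0 < stepsize_lb.
Proof. by rewrite lt_min hmu1 andbT divr_gt0 ?exprn_gt0. Qed.

Lemma gradient_sqr yd s : B (gR (st_xi s)) ->
  nX (gradient yd s) ^+ 2 <= Lc ^+ 2 * nY (residual yd s) ^+ 2.
Proof.
move=> Bx; rewrite -exprMn ler_pXn2r ?nnegrE ?mulr_ge0 ?ipnorm_ge0 // ?(ltW hLc) //.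
exact: Lstar_norm.
Qed.

(** The factor [nY (residual yd s) ^+ 2] covers the exact adaptive rule, whose step size is 0 at a
    zero residual. *)
Lemma stepsize_ge exact yd s : B (gR (st_xi s)) ->
  stepsize_lb * nY (residual yd s) ^+ 2 <= stepsize exact yd s * nY (residual yd s) ^+ 2.
Proof.
move=> Bx; have [r0|r0] := eqVneq (residual yd s) 0.
  by rewrite r0 (ipnorm0 hY) expr0n !mulr0.
rewrite ler_wpM2r ?sqr_ge0 // /stepsize /step_size /stepsize_lb (negbTE r0) andbF.
case: ifP => _; first by rewrite ge_min lexx.
case: ifPn => g0; first by rewrite ge_min lexx orbT.
rewrite le_min ge_min ge_min lexx orbT andbT.
apply/orP; left; rewrite ler_pdivlMr ?exprn_gt0 ?(ipnorm_gt0 hX) //.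
rewrite mulrAC ler_pdivrMr ?exprn_gt0 //.
by rewrite -mulrA ler_pM2l // mulrC gradient_sqr.
Qed.

(** This controls the quadratic gradient term of a step; the constant rule needs the bound on [L],
    the adaptive rule is built for it. *)
Lemma stepsize_gradient exact yd s : B (gR (st_xi s)) ->
  stepsize exact yd s * nX (gradient yd s) ^+ 2 <= mu0 * nY (residual yd s) ^+ 2.
Proof.
move=> Bx; rewrite /stepsize /step_size.
have m0 : 0 <= mu0 * nY (residual yd s) ^+ 2 by rewrite mulr_ge0 ?sqr_ge0 // ltW.
case: ifP => _.
  by rewrite mulrAC ler_pdivrMr ?exprn_gt0 // -mulrA ler_pM2l // mulrC gradient_sqr.
case: ifP => _; first by rewrite mul0r.
case: ifPn => [/eqP->|g0]; first by rewrite (ipnorm0 hX) expr0n mulr0.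
by rewrite -ler_pdivlMr ?exprn_gt0 ?(ipnorm_gt0 hX) // ge_min lexx.
Qed.

Lemma inertia_range exact yd s : 0 <= inertia exact yd s <= beta.
Proof.
have /andP[b0 _] := hbeta.
rewrite /inertia; case: ifP => _; first by rewrite lexx b0.
by rewrite le_min le_max lexx b0 /= ge_min lexx orbT.
Qed.

(* The inertia minimises over [0, beta] the quadratic that bounds the Bregman distance
   after the step, so it does at least as well as the choice [b = 0]. *)
Lemma inertia_opt exact yd s (b := inertia exact yd s) :
  b ^+ 2 * nX (momentum s) ^+ 2 + 4 * sigma * b * st_gam s
    <= 2 * b * stepsize exact yd s * ipX (gradient yd s) (momentum s).
Proof.
have /andP[] := inertia_range exact yd s; rewrite -/b => b0 _.
have : b = 0 \/ 0 < nX (momentum s) ^+ 2 /\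
    b <= (stepsize exact yd s * ipX (gradient yd s) (momentum s)
           - 2 * sigma * st_gam s) / nX (momentum s) ^+ 2.
  have [|b1] := eqVneq b 0; [by left | right].
  move: b1; rewrite /b /inertia; case: ifPn => [_|m0 b1]; first by rewrite eqxx.
  split; first by rewrite exprn_gt0 // (ipnorm_gt0 hX).
  have /andP[beta0 _] := hbeta.
  move: b1; set q := _ / _; case: (leP 0 q) => q0; first by rewrite ge_min lexx.
  by rewrite (min_idPl beta0) eqxx.
case=> [->|[mp]]; first by rewrite expr0n !(mul0r, mulr0) addr0.
rewrite ler_pdivlMr // => h.
have : 0 <= b * nX (momentum s) ^+ 2 by rewrite mulr_ge0 ?sqr_ge0.
have := ler_wpM2l b0 h; nra.
Qed.

(** * Bregman descent in one step *)

Section OneStep.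
Variables (exact : bool) (yd : Y) (delta : R) (s : alg_state X R) (xh : X).
Let x := gR (st_xi s).
Let r := residual yd s.
Let a := stepsize exact yd s.
Let s' := step exact yd delta s.
Hypotheses (Bx : B x) (Bxh : B xh) (Fxh : F xh = y) (hyd : nY (yd - y) <= delta).
Hypothesis gam_s : ipX (momentum s) (x - xh) <= st_gam s.

(** [st_gam] is a computable substitute for the inner product of the momentum with [x - xh], where
    the solution [xh] is unknown. *)
Lemma step_inner_bound :
  ipX (momentum s') (x - xh) <= - (1 - eta) * a * nY r ^+ 2
    + (1 + eta) * a * delta * nY r + inertia exact yd s * st_gam s.
Proof.
rewrite step_momentum (ipDl hX) (ipNl hX) !(ipZl hX).
have /andP[b0 _] := inertia_range exact yd s.
have h1 : a * - ipX (gradient yd s) (x - xh) <=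
    a * (- (1 - eta) * nY r ^+ 2 + (1 + eta) * delta * nY r).
  by rewrite ler_wpM2l ?stepsize_ge0 //; exact: gradient_inner_bound.
have h2 := ler_wpM2l b0 gam_s.
by rewrite -/a; lra.
Qed.

(** The recursion for [st_gam] is the bound of [step_inner_bound] plus the inner product of the new
    momentum with the primal increment, so the hypothesis [gam_s] is inherited. *)
Lemma step_gam_bound : ipX (momentum s') (gR (st_xi s') - xh) <= st_gam s'.
Proof.
have -> : ipX (momentum s') (gR (st_xi s') - xh) =
    ipX (momentum s') (gR (st_xi s') - x) + ipX (momentum s') (x - xh).
  by rewrite -(ipDr hX) subrKA.
by rewrite step_gam -/s' -/r -/a -/x; have := step_inner_bound; lra.
Qed.

(** In the three-point identity, [bregR_le] produces the squared new momentum. Once expanded,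
    [inertia_opt] turns its inertial terms into [- inertia * st_gam], cancelling the term of
    [step_inner_bound], and [stepsize_gradient] bounds the rest. *)
Lemma step_bregR :
  D (st_xi s') xh <= D (st_xi s) xh
    - (1 - eta - mu0 / (4 * sigma)) * (a * nY r ^+ 2) + (1 + eta) * a * (delta * nY r).
Proof.
have dm : st_xi s' - st_xi s = momentum s' by [].
have ch := @bregR_change _ _ _ Rf gR hX (st_xi s') (st_xi s) xh.
have le := bregR_le hX hsigma hproper hconv hgR (st_xi s') (st_xi s).
rewrite {}dm -/x in ch le.
have s4 : 0 < 4 * sigma by rewrite mulr_gt0.
suff : nX (momentum s') ^+ 2 / (4 * sigma)
    <= mu0 / (4 * sigma) * (a * nY r ^+ 2) - inertia exact yd s * st_gam s.
  by have := step_inner_bound; nra.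
rewrite ler_pdivrMr // mulrBl (mulrAC _ (a * _)) divfK ?gt_eqF //.
have a0 := stepsize_ge0 exact yd s; rewrite -/a in a0.
have h1 := ler_wpM2l a0 (stepsize_gradient exact yd Bx); rewrite -/a -/r in h1.
have h2 := inertia_opt exact yd s; rewrite -/a /= in h2.
by rewrite step_momentum (ipnorm_sqrB_scaled hX) -/a; lra.
Qed.

End OneStep.

(** * Discrepancy principle and descent along a run *)

Hypotheses (htau : 1 < tau) (hrho : 0 < rho).
Let c := 1 - (1 + eta) / tau - eta - mu0 / (4 * sigma).
Hypothesis hpar : 0 < c.
Hypothesis x0E : x0 = gR xi0.
Variable xb : X.
Hypotheses (xbd : edom Rf xb) (Fxb : F xb = y) (Dxb : D xi0 xb <= sigma * rho ^+ 2).
Notation run := (alg_states ipX ipY gR F Lstar eta sigma mu0 mu1 Lc beta adaptive xi0).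

Lemma norm_le_bregR xi z t : 0 <= t -> edom Rf z -> D xi z <= sigma * t ^+ 2 ->
  nX (z - gR xi) <= t.
Proof.
move=> t0 zd h; rewrite -(@ler_pXn2r _ 2) ?nnegrE ?ipnorm_ge0 //.
rewrite -(ler_pM2l hsigma); apply: le_trans h.
exact: (bregR_ge hX hsigma hproper hconv hgR).
Qed.

Lemma xb_ball : B xb.
Proof.
have := norm_le_bregR (ltW hrho) xbd Dxb; rewrite -x0E /hball /=.
by have := hrho; lra.
Qed.

(** Both [x0] and [gR xi] are within [rho] of [xb]; this is where the radius [2 * rho] comes
    from. *)
Lemma ball_of_bregR xi : D xi xb <= sigma * rho ^+ 2 -> B (gR xi).
Proof.
move=> /(norm_le_bregR (ltW hrho) xbd); rewrite (ipnormBC hX) => h1.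
have := norm_le_bregR (ltW hrho) xbd Dxb; rewrite -x0E => h2.
by have := ipnormB_le hX (gR xi) xb x0; rewrite /hball /=; lra.
Qed.

(* The descent estimate absorbs the noise as long as the discrepancy principle fails;
   it also holds when [delta = 0]. *)
Definition noise_dominated yd delta s :=
  delta * nY (residual yd s) <= nY (residual yd s) ^+ 2 / tau.

Lemma noise_dominated_gt yd delta s :
  tau * delta < nY (residual yd s) -> noise_dominated yd delta s.
Proof.
move=> h; rewrite /noise_dominated ler_pdivlMr; last exact: lt_trans htau.
by have := @ipnorm_ge0 _ _ ipY (residual yd s); nra.
Qed.

Lemma noise_dominated0 yd s : noise_dominated yd 0 s.
Proof.
by rewrite /noise_dominated mul0r divr_ge0 ?sqr_ge0 // ltW // (lt_trans _ htau).
Qed.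

Lemma step_descent exact yd delta s xh :
  B (gR (st_xi s)) -> B xh -> F xh = y -> nY (yd - y) <= delta ->
  ipX (momentum s) (gR (st_xi s) - xh) <= st_gam s ->
  noise_dominated yd delta s ->
  D (st_xi (step exact yd delta s)) xh <=
    D (st_xi s) xh - c * (stepsize exact yd s * nY (residual yd s) ^+ 2).
Proof.
move=> Bx Bxh Fxh hyd gam reg.
have := step_bregR exact Bx Bxh Fxh hyd gam.
have /andP[e0 _] := heta.
have a0 : 0 <= (1 + eta) * stepsize exact yd s.
  by rewrite mulr_ge0 ?stepsize_ge0 // addr_ge0.
have := ler_wpM2l a0 reg; rewrite /c; lra.
Qed.

Section Run.
Variables (exact : bool) (yd : Y) (delta : R).
Hypothesis hyd : nY (yd - y) <= delta.
Notation st := (run exact yd delta).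

(** The claims need each other: the ball and the bound on [st_gam] give descent, and descent towards
    [xb] keeps the next iterate in the ball. The bound is stated for all solutions because descent
    is later applied to the limit too. *)
Lemma run_inv n : (forall i, (i < n)%N -> noise_dominated yd delta (st i)) ->
  [/\ B (gR (st_xi (st n))), D (st_xi (st n)) xb <= sigma * rho ^+ 2 &
      forall xh, B xh -> F xh = y ->
        ipX (momentum (st n)) (gR (st_xi (st n)) - xh) <= st_gam (st n)].
Proof.
elim: n => [_|n IH reg].
  split=> //=; first exact: ball_of_bregR.
  by move=> xh _ _; rewrite /momentum /= subrr (ip0l hX).
have [Bn Dn gn] : _ := IH (fun i hi => reg i (ltnW hi)).
have Dn1 : D (st_xi (st n.+1)) xb <= sigma * rho ^+ 2.
  apply: le_trans Dn.
  apply: le_trans (step_descent _ Bn xb_ball Fxb hyd (gn _ xb_ball Fxb) (reg n _)) _ => //.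
  by rewrite gerBl mulr_ge0 ?(ltW hpar) // mulr_ge0 ?stepsize_ge0 ?sqr_ge0.
split=> //; first exact: ball_of_bregR.
by move=> xh Bxh Fxh; apply: step_gam_bound => //; exact: gn.
Qed.

Lemma run_descent n xh : B xh -> F xh = y ->
  (forall i, (i <= n)%N -> noise_dominated yd delta (st i)) ->
  D (st_xi (st n.+1)) xh <= D (st_xi (st n)) xh
    - c * (stepsize exact yd (st n) * nY (residual yd (st n)) ^+ 2).
Proof.
move=> Bxh Fxh reg.
have [Bn _ gn] : _ := run_inv (fun i hi => reg i (ltnW hi)).
by apply: step_descent => //; [exact: gn | exact: reg].
Qed.

Lemma run_mono n m xh : B xh -> F xh = y ->
  (forall i, (i < m)%N -> noise_dominated yd delta (st i)) -> (n <= m)%N ->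
  D (st_xi (st m)) xh <= D (st_xi (st n)) xh.
Proof.
move=> Bxh Fxh; elim: m => [|m IH] reg; first by rewrite leqn0 => /eqP ->.
rewrite leq_eqVlt ltnS => /predU1P[->//|nm].
have IHm := IH (fun i hi => reg i (ltnW hi)) nm; apply: le_trans IHm.
apply: le_trans (run_descent Bxh Fxh reg) _.
by rewrite gerBl mulr_ge0 ?(ltW hpar) // mulr_ge0 ?stepsize_ge0 ?sqr_ge0.
Qed.

(** If all residuals from [N] on exceeded [e], the distance to [xb] would drop by at least
    [c * (stepsize_lb * e ^+ 2)] in each step. *)
Lemma residual_small_infinitely_often e N : 0 < e ->
  (forall n, e < nY (residual yd (st n)) -> noise_dominated yd delta (st n)) ->
  (forall n, (n < N)%N -> noise_dominated yd delta (st n)) ->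
  exists2 n, (N <= n)%N & nY (residual yd (st n)) <= e.
Proof.
move=> e0 reg regN; apply: contrapT => H.
have big n : e < nY (residual yd (st (N + n))).
  by rewrite ltNge; apply/negP => h; apply: H; exists (N + n)%N => //; exact: leq_addr.
have regall i : noise_dominated yd delta (st i).
  have [/regN//|Ni] := ltnP i N.
  by apply: reg; rewrite -(subnKC Ni).
apply: (@no_unbounded_decrease _ (fun n => D (st_xi (st (N + n))) xb)
         (c * (stepsize_lb * e ^+ 2))).
- by rewrite mulr_gt0 // mulr_gt0 ?stepsize_lb_gt0 // exprn_gt0.
- by move=> n; exact: (bregR_ge0 hX hsigma hproper hconv hgR).
- move=> n; rewrite addnS.
  apply: le_trans (run_descent xb_ball Fxb (fun i _ => regall i)) _.
  have [Bn _ _] : _ := run_inv (n := (N + n)%N) (fun i _ => regall i).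
  rewrite lerD2l lerN2 ler_pM2l //; apply: le_trans (stepsize_ge exact yd Bn).
  rewrite ler_pM2l ?stepsize_lb_gt0 // ler_pXn2r ?nnegrE ?ipnorm_ge0 ?(ltW e0) //.
  exact: ltW.
Qed.

End Run.

Lemma stopping_index_exists yd delta : 0 < delta -> nY (yd - y) <= delta ->
  exists n, is_stopping_index ipX ipY gR F Lstar eta sigma mu0 mu1 Lc beta adaptive
    xi0 tau yd delta n.
Proof.
move=> d0 hyd.
have td : 0 < tau * delta by rewrite mulr_gt0 // (lt_trans _ htau).
have [n _ hn] : exists2 n, (0 <= n)%N & nY (residual yd (run false yd delta n)) <= tau * delta.
  apply: residual_small_infinitely_often => //.
  by move=> n; exact: noise_dominated_gt.
have ex : exists n, nY (residual yd (run false yd delta n)) <= tau * delta by exists n.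
case: (ex_minnP ex) => m hm minm; exists m; split=> // k km.
by rewrite ltNge; apply/negP => /minm; rewrite leqNgt km.
Qed.

Lemma stopping_index_dominated yd delta n :
  is_stopping_index ipX ipY gR F Lstar eta sigma mu0 mu1 Lc beta adaptive
    xi0 tau yd delta n ->
  forall i, (i < n)%N -> noise_dominated yd delta (run false yd delta i).
Proof. by move=> [_ h] i /h; exact: noise_dominated_gt. Qed.

Variable domF : set X.
Hypothesis hsubF : B `<=` domF.
Hypothesis hweak : forall (u : nat -> X) (x : X) (v : Y),
  (forall n, domF (u n)) -> weak_cvg ipX u x -> strong_cvg ipY (F \o u) v ->
  domF x /\ F x = v.

(** * Exact data *)

Section ExactData.
Notation st := (run true y 0).
Notation rn := (fun n => nY (residual y (st n))).

Lemma exact_hyd : nY (y - y) <= 0.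
Proof. by rewrite subrr (ipnorm0 hY). Qed.

Let reg n i (_ : (i < n)%N) : noise_dominated y 0 (st i) := noise_dominated0 y (st i).

Lemma exact_ball n : B (gR (st_xi (st n))).
Proof. by case: (run_inv exact_hyd (reg (n := n))). Qed.

Lemma exact_descent n xh : B xh -> F xh = y ->
  D (st_xi (st n.+1)) xh <= D (st_xi (st n)) xh
    - c * (stepsize true y (st n) * rn n ^+ 2).
Proof. by move=> Bxh Fxh; apply: (run_descent exact_hyd) => // i _; exact: noise_dominated0. Qed.

Lemma exact_mono n m xh : B xh -> F xh = y -> (n <= m)%N ->
  D (st_xi (st m)) xh <= D (st_xi (st n)) xh.
Proof. by move=> Bxh Fxh; apply: (run_mono exact_hyd) => // i _; exact: noise_dominated0. Qed.

(* If [x_n] is a solution, its own Bregman distance vanishes and cannot increase. *)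
Lemma exact_stationary n m : residual y (st n) = 0 -> (n <= m)%N ->
  gR (st_xi (st m)) = gR (st_xi (st n)).
Proof.
move=> /eqP; rewrite subr_eq0 => /eqP Fn nm.
have xd := edom_gR hgR (st_xi (st n)).
have := exact_mono (exact_ball n) Fn nm; rewrite (bregR_self hX) => Dm.
have := norm_le_bregR (lexx 0) xd (le_trans Dm _).
rewrite expr0n mulr0 => /(_ (lexx 0)) xm0.
have /eqP : nX (gR (st_xi (st n)) - gR (st_xi (st m))) == 0.
  by rewrite eq_le xm0 ipnorm_ge0.
by move=> /eqP; rewrite (ipnorm_eq0 hX) subr_eq0 => /eqP ->.
Qed.

Lemma exact_residual_small e N : 0 < e -> exists2 n, (N <= n)%N & rn n <= e.
Proof.
move=> e0; apply: (residual_small_infinitely_often exact_hyd) => // n _;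
exact: noise_dominated0.
Qed.

(** * Record indices of the residual and the exact limit *)

Definition residual_record k := forall i, (i <= k)%N -> rn k <= rn i.

(** A zero residual at [N] is a record. Otherwise no earlier residual vanishes, by stationarity, so
    some [e > 0] lies below all residuals up to [N], and the first index from [N] on with residual
    at most [e] is a record. *)
Lemma residual_record_exists N : exists2 k, (N <= k)%N & residual_record k.
Proof.
have [rN0|rN0] := eqVneq (residual y (st N)) 0.
  by exists N => // i _; rewrite rN0 (ipnorm0 hY) ipnorm_ge0.
have [e e0 he] : exists2 e, 0 < e & forall i, (i <= N)%N -> e <= rn i.
  have nz i : (i <= N)%N -> 0 < rn i.
    move=> iN; rewrite (ipnorm_gt0 hY); apply: contra_neq rN0 => ri0.
    by rewrite /residual (exact_stationary ri0 iN).
  have {nz} : forall M, (M <= N)%N ->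
      exists2 e, 0 < e & forall i, (i <= M)%N -> e <= rn i.
    elim=> [_|M IH MN].
      by exists (rn 0%N); [exact: nz | move=> i; rewrite leqn0 => /eqP ->].
    have [e e0 he] := IH (ltnW MN).
    exists (Num.min e (rn M.+1)); first by rewrite lt_min e0 nz.
    move=> i; rewrite leq_eqVlt => /predU1P[->|/he h]; first by rewrite ge_min lexx orbT.
    by rewrite ge_min h.
  by apply.
have [n Nn hn] := exact_residual_small N e0.
have ex : exists n, (N <= n)%N && (rn n <= e) by exists n; rewrite Nn.
case: (ex_minnP ex) => k /andP[Nk rk] kmin; exists k => // i ik.
have [iN|Ni] := leqP i N; first exact: le_trans rk (he _ iN).
move: ik; rewrite leq_eqVlt => /predU1P[->//|ik].
apply: le_trans rk _; rewrite leNgt; apply/negP => /ltW ri.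
by have := kmin i; rewrite (ltnW Ni) ri /= leqNgt ik => /(_ isT).
Qed.

Definition decrement n : R := stepsize true y (st n) * rn n ^+ 2.

(** The recursion of [step_momentum] with the inertia replaced by [beta] and the gradient term by
    its bound at record indices. *)
Fixpoint momentum_bound n : R :=
  if n is n'.+1 then beta * momentum_bound n' + 3 * (1 + eta) * decrement n' else 0.

Lemma decrement_ge0 n : 0 <= decrement n.
Proof. by rewrite mulr_ge0 ?stepsize_ge0 ?sqr_ge0. Qed.

Lemma momentum_bound_ge0 n : 0 <= momentum_bound n.
Proof.
have /andP[e0 _] := heta; have /andP[b0 _] := hbeta.
elim: n => //= n IH; have e3 : 0 <= 3 * (1 + eta) by rewrite mulr_ge0 // addr_ge0.
by rewrite addr_ge0 // mulr_ge0 // decrement_ge0.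
Qed.

(** Go through [x_n]: by the record property [F x_k] is within two residuals of [F x_n], and
    [F xh = y] within one, whence the factor 3. *)
Lemma gradient_inner_record k n xh : B xh -> F xh = y -> residual_record k -> (n <= k)%N ->
  `|ipX (gradient y (st n)) (gR (st_xi (st k)) - xh)| <= 3 * (1 + eta) * rn n ^+ 2.
Proof.
move=> Bxh Fxh rec nk; have /andP[e0 _] := heta.
rewrite hadj; last exact: exact_ball.
set xn := gR (st_xi (st n)); set xk := gR (st_xi (st k)).
have Bn : B xn by exact: exact_ball.
have Bk : B xk by exact: exact_ball.
apply: le_trans (ip_CS hY _ _) _.
suff h : nY (L xn (xk - xh)) <= 3 * (1 + eta) * rn n.
  by rewrite expr2 mulrA mulrC ler_wpM2r ?ipnorm_ge0.
have -> : L xn (xk - xh) = L xn (xk - xn) - L xn (xh - xn).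
  by rewrite -LB // opprB addrA subrK.
apply: le_trans (ipnormD hY _ _) _; rewrite (ipnormN hY).
have h1 := L_le_residual Bn Bk; have h2 := L_le_residual Bn Bxh.
have h3 := ipnormB_le hY (F xk) y (F xn).
have rk : nY (F xk - y) <= nY (F xn - y) := rec n nk.
rewrite Fxh (ipnormBC hY y) in h2 h3; rewrite /residual -/xn.
have h4 : (1 + eta) * nY (F xk - F xn) <= (1 + eta) * (2 * nY (F xn - y)).
  by rewrite ler_wpM2l ?addr_ge0 //; lra.
by lra.
Qed.

Lemma momentum_inner_record k n xh : B xh -> F xh = y -> residual_record k -> (n <= k)%N ->
  `|ipX (momentum (st n)) (gR (st_xi (st k)) - xh)| <= momentum_bound n.
Proof.
move=> Bxh Fxh rec; elim: n => [_|n IH nk].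
  by rewrite /momentum /= subrr (ip0l hX) normr0.
rewrite [st n.+1]/(step true y 0 (st n)) step_momentum (ipDl hX) (ipNl hX) !(ipZl hX).
have /andP[b0 b1] := inertia_range true y (st n).
have a0 := stepsize_ge0 true y (st n).
apply: le_trans (ler_normB _ _) _; rewrite !normrM (ger0_norm b0) (ger0_norm a0) /=.
apply: lerD.
  by apply: ler_pM => //; exact: IH (ltnW nk).
rewrite /decrement mulrCA ler_wpM2l //.
exact: gradient_inner_record (ltnW nk).
Qed.

Definition momentum_sum n : R := \sum_(0 <= i < n) momentum_bound i.

Lemma momentum_sumS n : momentum_sum n.+1 = momentum_sum n + momentum_bound n.
Proof. by rewrite /momentum_sum big_nat_recr. Qed.

(** Telescoping. State [n] holds the momentum [xi_n - xi_(n-1)], so the bounds of index [m + 1] to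
    [m + j] enter, hence the successors in [momentum_sum]. *)
Lemma xi_inner_record k m j xh : B xh -> F xh = y -> residual_record k ->
  (m + j <= k)%N ->
  `|ipX (st_xi (st (m + j)) - st_xi (st m)) (gR (st_xi (st k)) - xh)|
    <= momentum_sum (m + j).+1 - momentum_sum m.+1.
Proof.
move=> Bxh Fxh rec; elim: j => [_|j IH mjk].
  by rewrite addn0 !subrr (ip0l hX) normr0.
rewrite addnS in mjk *.
have -> : st_xi (st (m + j).+1) - st_xi (st m) =
    momentum (st (m + j).+1) + (st_xi (st (m + j)) - st_xi (st m)).
  by rewrite subrKA.
rewrite (ipDl hX) momentum_sumS addrAC addrC.
apply: le_trans (ler_normD _ _) _; apply: lerD.
  exact: momentum_inner_record.
exact: IH (ltnW mjk).
Qed.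

Lemma decrement_sum_le n : c * \sum_(0 <= i < n) decrement i <= D xi0 xb.
Proof.
suff : D (st_xi (st n)) xb <= D xi0 xb - c * \sum_(0 <= i < n) decrement i.
  by have := bregR_ge0 hX hsigma hproper hconv hgR (st_xi (st n)) xbd; lra.
elim: n => [|n IH]; first by rewrite big_nil mulr0 subr0.
rewrite big_nat_recr //= mulrDr.
by have := exact_descent n xb_ball Fxb; rewrite -/(decrement n); lra.
Qed.

(** Summing the recursion bounds the sum by [beta] times itself plus a multiple of the summable
    decrements; [beta < 1] lets it be solved for. *)
Lemma momentum_sum_le n :
  momentum_sum n <= 3 * (1 + eta) / (1 - beta) * (D xi0 xb / c).
Proof.
have /andP[e0 _] := heta; have /andP[b0 b1] := hbeta.
have rec : momentum_sum n.+1 = beta * momentum_sum n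
    + 3 * (1 + eta) * \sum_(0 <= i < n) decrement i.
  by rewrite /momentum_sum big_nat_recl //= add0r big_split /= -!mulr_sumr.
have := momentum_bound_ge0 n; rewrite momentum_sumS in rec.
have := decrement_sum_le n; rewrite mulrC -ler_pdivlMr // => h h0.
rewrite mulrAC ler_pdivlMr ?subr_gt0 //.
have e3 : 0 <= 3 * (1 + eta) by rewrite mulr_ge0 // addr_ge0.
have := ler_wpM2l e3 h; lra.
Qed.

Let Phi n : R := D (st_xi (st n)) xb - momentum_sum n.+1.

(** Apply the three-point identity to [x_m], [x_k] and [xb]; the inner product is absorbed by the
    momentum sums contained in [Phi]. *)
Lemma record_bregR k m : residual_record k -> (m <= k)%N ->
  D (st_xi (st m)) (gR (st_xi (st k))) <= Phi m - Phi k.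
Proof.
move=> rec mk.
have := xi_inner_record xb_ball Fxb rec (m := m) (j := k - m).
rewrite subnKC // => /(_ (leqnn k)); rewrite ler_norml => /andP[_ h].
have -> : D (st_xi (st m)) (gR (st_xi (st k))) = D (st_xi (st m)) xb
    - D (st_xi (st k)) xb + ipX (st_xi (st k) - st_xi (st m)) (gR (st_xi (st k)) - xb).
  by rewrite /bregR !(ipE hX); ring.
by rewrite /Phi; lra.
Qed.

Lemma Phi_cvg : exists2 l, Phi @ \oo --> l & forall n, l <= Phi n.
Proof.
have dec : {homo Phi : n m / (n <= m)%N >-> m <= n}.
  move=> n m nm; apply: lerB; first exact: exact_mono xb_ball Fxb nm.
  by elim: m nm => [|m IH]; [rewrite leqn0 => /eqP -> |
    rewrite leq_eqVlt ltnS => /predU1P[->//|/IH h];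
    rewrite [leRHS]momentum_sumS; apply: le_trans h _; rewrite lerDl momentum_bound_ge0].
have lb n : - (3 * (1 + eta) / (1 - beta) * (D xi0 xb / c)) <= Phi n.
  have := bregR_ge0 hX hsigma hproper hconv hgR (st_xi (st n)) xbd.
  by have := momentum_sum_le n.+1; rewrite /Phi; lra.
have cv : cvgn Phi.
  by apply: nonincreasing_is_cvgn => //; eexists => _ [n _ <-]; exact: lb.
exists (limn Phi) => // n; exact: nonincreasing_cvgn_ge.
Qed.

Lemma exact_limit : exists xs,
  [/\ F xs = y, B xs, edom Rf xs &
      (fun n => D (st_xi (st n)) xs) @ \oo --> (0 : R)].
Proof.
have [l Phil lPhi] := Phi_cvg.
have /choice[k hk] : forall N, exists k, (N <= k)%N /\ residual_record k.
  by move=> N; have [k] := residual_record_exists N; exists k.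
pose u j := gR (st_xi (st (k j))).
have kd m j : (m <= j)%N -> D (st_xi (st m)) (u j) <= Phi m - l.
  move=> mj; have [jk rec] := hk j.
  by apply: le_trans (record_bregR rec (leq_trans mj jk)) _; rewrite lerD2l lerN2.
have [xs uxs] : exists xs, strong_cvg ipX u xs.
  case: (hX) => _ _ _ _; apply => e e0.
  have e2 : 0 < e / 2 by rewrite divr_gt0.
  have se : 0 < sigma * (e / 2) ^+ 2 by rewrite mulr_gt0 ?exprn_gt0.
  have [N _ hN] : \forall n \near \oo, Phi n < l + sigma * (e / 2) ^+ 2.
    by apply: (cvgr_lt _ Phil); rewrite ltrDl.
  (* The record iterates are compared with the single iterate of index [N], not directly with each
     other. *)
  have uN j : (N <= j)%N -> nX (u j - gR (st_xi (st N))) < e / 2.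
    move=> Nj; have := kd N j Nj; have := hN N (leqnn N) => h1 h2.
    rewrite -(@ltr_pXn2r _ 2) ?nnegrE ?ipnorm_ge0 ?(ltW e2) //.
    rewrite -(ltr_pM2l hsigma).
    apply: le_lt_trans (bregR_ge hX hsigma hproper hconv hgR _ _) _.
      exact: (edom_gR hgR).
    by rewrite /= in h1; lra.
  exists N => i j Ni Nj.
  have := ipnormB_le hX (u i) (gR (st_xi (st N))) (u j).
  have := uN i Ni; have := uN j Nj; rewrite (ipnormBC hX (u j)); lra.
have Bu j : B (u j) by exact: exact_ball.
have Fu : strong_cvg ipY (F \o u) y.
  apply: (cvg0P_le (u := fun j => nY (F (u j) - y))); first by move=> n; exact: ipnorm_ge0.
  move=> e e0; have [n _ hn] := exact_residual_small 0 e0.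
  exists n => // j /= nj; have [jk rec] := hk j.
  exact: le_trans (rec n (leq_trans nj jk)) hn.
have [_ Fxs] := hweak (fun j => hsubF (Bu j)) (strong_cvg_weak hX uxs) Fu.
(* Here [m] is fixed and only the record index tends to infinity, so the bound holds for every [m],
   record or not. *)
have lim m : edom Rf xs /\ D (st_xi (st m)) xs <= Phi m - l.
  have ud j : edom Rf (u j) by exact: (edom_gR hgR).
  apply: (bregR_lsc hX hproper hlsc uxs ud).
  by exists m => // j /= mj; exact: kd.
exists xs; split=> //; first exact: hball_strong_limit Bu uxs; first by case: (lim 0%N).
apply: (cvg0_dom (v := fun m => Phi m - l)).
  near=> m; have [xsd ->] := lim m; rewrite andbT.
  exact: (bregR_ge0 hX hsigma hproper hconv hgR).
by rewrite -(subrr l); apply: cvgB => //; exact: cvg_cst.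
Unshelve. all: by end_near. Qed.

End ExactData.

(** For exact data, a zero gradient would turn [gradient_inner_bound] into
    [0 <= - (1 - eta) * r ^+ 2] for the residual norm [r]. *)
Lemma exact_gradient_neq0 n : residual y (run true y 0 n) != 0 ->
  gradient y (run true y 0 n) != 0.
Proof.
rewrite -(ipnorm_gt0 hY) => r0; apply/eqP => g0.
have := gradient_inner_bound (exact_ball n) xb_ball Fxb exact_hyd.
rewrite -/(residual y _) -/(gradient y _) g0 (ip0l hX) oppr0 mulr0 mul0r addr0.
have /andP[_ e1] := heta.
have : 0 < (1 - eta) * nY (residual y (run true y 0 n)) ^+ 2.
  by rewrite mulr_gt0 ?subr_gt0 // exprn_gt0.
by rewrite mulNr; lra.
Qed.

(* Otherwise [xi_n.+1 = xi_n], against the strict decrease of the Bregman distance. *)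
Lemma exact_momentum_eq0 n : residual y (run true y 0 n) != 0 ->
  momentum (run true y 0 n.+1) != 0.
Proof.
rewrite -(ipnorm_gt0 hY) => r0; apply/eqP => m0.
have := exact_descent n xb_ball Fxb.
have -> : st_xi (run true y 0 n.+1) = st_xi (run true y 0 n).
  by apply/eqP; rewrite -subr_eq0; apply/eqP.
have : 0 < stepsize_lb * nY (residual y (run true y 0 n)) ^+ 2.
  by rewrite mulr_gt0 ?stepsize_lb_gt0 // exprn_gt0.
have := stepsize_ge true y (exact_ball n) => h1 h2.
have : 0 < c * (stepsize true y (run true y 0 n) * nY (residual y (run true y 0 n)) ^+ 2).
  by rewrite mulr_gt0 //; exact: lt_le_trans h1.
by lra.
Qed.

(** * Noisy data *)

Section NoisyData.
Variables (delta : nat -> R) (yd : nat -> Y).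
Hypothesis hdelta : delta @ \oo --> (0 : R).
Hypothesis hyd : forall l, nY (yd l - y) <= delta l.

Lemma data_cvg : strong_cvg ipY yd y.
Proof. by apply: (strong_cvg_dom (v := delta)) => //; near=> l; exact: hyd.
Unshelve. all: by end_near. Qed.

(** * Continuity of one step in the data *)

Section StepStability.
Variables (sl : nat -> alg_state X R) (s : alg_state X R).
Hypothesis xi_cvg : strong_cvg ipX (fun l => st_xi (sl l)) (st_xi s).
Hypothesis prev_cvg : strong_cvg ipX (fun l => st_xi_prev (sl l)) (st_xi_prev s).
Hypothesis gam_cvg : (fun l => st_gam (sl l)) @ \oo --> st_gam s.
Hypotheses (Bs : B (gR (st_xi s))) (Bsl : \forall l \near \oo, B (gR (st_xi (sl l)))).

Let x_cvg : strong_cvg ipX (fun l => gR (st_xi (sl l))) (gR (st_xi s)).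
Proof. exact: (gR_continuous hX hsigma hproper hconv hgR). Qed.

Lemma residual_cvg : strong_cvg ipY (fun l => residual (yd l) (sl l)) (residual y s).
Proof. by apply: (strong_cvgB hY); [exact: F_continuous | exact: data_cvg]. Qed.

Let r_cvg := cvg_ipnorm hY residual_cvg.

Lemma gradient_cvg : strong_cvg ipX (fun l => gradient (yd l) (sl l)) (gradient y s).
Proof. by apply: Lstar_continuous => //; exact: residual_cvg. Qed.

Lemma momentum_cvg : strong_cvg ipX (fun l => momentum (sl l)) (momentum s).
Proof. exact: (strong_cvgB hX). Qed.

Hypotheses (r_neq0 : residual y s != 0) (g_neq0 : gradient y s != 0).
Hypothesis m_eq0 : momentum s = 0 -> forall l, momentum (sl l) = 0.

(** The exact and noisy conventions differ only at a zero residual, and the default for a zero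
    gradient is eventually avoided. *)
Lemma stepsize_cvg :
  (fun l => stepsize false (yd l) (sl l)) @ \oo --> stepsize true y s.
Proof.
rewrite /stepsize /step_size (negbTE r_neq0) (negbTE g_neq0) /=.
case: adaptive => /=; last exact: cvg_cst.
pose u l := Num.min (mu0 * nY (residual (yd l) (sl l)) ^+ 2
                     / nX (gradient (yd l) (sl l)) ^+ 2) mu1.
apply: (@cvg_trans _ (u @ \oo)).
  apply: near_eq_cvg; apply: filterS (strong_cvg_near_neq0 hX gradient_cvg g_neq0).
  by move=> l /negbTE ->.
apply: cvg_min; last exact: cvg_cst.
have g_cvg := cvg_ipnorm hX gradient_cvg.
apply: cvgM; first by apply: cvgM; [exact: cvg_cst | exact: cvgM].
apply: cvgV; last exact: cvgM.
by rewrite expf_eq0 /= (ipnorm_eq0 hX).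
Qed.

(** The quotient is singular at zero momentum, hence [m_eq0]: if the limit momentum vanishes, all
    noisy ones do and every inertia is 0. *)
Lemma inertia_cvg :
  (fun l => inertia false (yd l) (sl l)) @ \oo --> inertia true y s.
Proof.
rewrite /inertia; case: ifPn => [/eqP m0|m0].
  by under eq_fun do rewrite m_eq0 // eqxx; exact: cvg_cst.
pose u l := Num.min (Num.max 0 ((stepsize false (yd l) (sl l)
    * ipX (gradient (yd l) (sl l)) (momentum (sl l))
    - 2 * sigma * st_gam (sl l)) / nX (momentum (sl l)) ^+ 2)) beta.
apply: (@cvg_trans _ (u @ \oo)).
  apply: near_eq_cvg; apply: filterS (strong_cvg_near_neq0 hX momentum_cvg m0).
  by move=> l /negbTE ->.
apply: cvg_min; last exact: cvg_cst.
apply: cvg_max; first exact: cvg_cst.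
have mn := cvg_ipnorm hX momentum_cvg.
apply: cvgM; last first.
  by apply: cvgV; [rewrite expf_eq0 /= (ipnorm_eq0 hX) | exact: cvgM].
apply: cvgB; last by apply: cvgM => //; exact: cvg_cst.
by apply: cvgM; [exact: stepsize_cvg | exact: (cvg_ip hX gradient_cvg momentum_cvg)].
Qed.

Lemma step_cvg (s' := step true y 0 s)
    (sl' := fun l => step false (yd l) (delta l) (sl l)) :
  [/\ strong_cvg ipX (fun l => st_xi (sl' l)) (st_xi s'),
      strong_cvg ipX (fun l => st_xi_prev (sl' l)) (st_xi_prev s') &
      (fun l => st_gam (sl' l)) @ \oo --> st_gam s'].
Proof.
have xi' : strong_cvg ipX (fun l => st_xi (sl' l)) (st_xi s').
  apply: (strong_cvgD hX); last exact: (strong_cvgZ hX inertia_cvg momentum_cvg).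
  by apply: (strong_cvgB hX) => //; exact: (strong_cvgZ hX stepsize_cvg gradient_cvg).
split=> //.
have x' := gR_continuous hX hsigma hproper hconv hgR xi'.
rewrite /sl' /s'; under eq_fun do rewrite step_gam.
rewrite step_gam.
have cc (a : R) : (fun=> a) @ \oo --> a by exact: cvg_cst.
apply: cvgD; last by apply: cvgM => //; exact: inertia_cvg.
apply: cvgD; last first.
  apply: cvgM => //; apply: cvgM => //; apply: cvgM => //; exact: stepsize_cvg.
apply: cvgB; first by apply: (cvg_ip hX); apply: (strong_cvgB hX).
by apply: cvgM; [apply: cvgM => //; exact: stepsize_cvg | exact: cvgM].
Qed.

End StepStability.
Notation nz := (fun l => run false (yd l) (delta l)).

(** The last claim is part of the induction: while the stopping test fails, the noise is dominated
    and the noisy iterates stay in the ball, as the continuity of the next step requires. *)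
Lemma noisy_cvg n : (forall i, (i < n)%N -> residual y (run true y 0 i) != 0) ->
  [/\ strong_cvg ipX (fun l => st_xi (nz l n)) (st_xi (run true y 0 n)),
      strong_cvg ipX (fun l => st_xi_prev (nz l n)) (st_xi_prev (run true y 0 n)),
      (fun l => st_gam (nz l n)) @ \oo --> st_gam (run true y 0 n) &
      \forall l \near \oo, forall i, (i < n)%N ->
        tau * delta l < nY (residual (yd l) (nz l i))].
Proof.
elim: n => [_|n IH r_neq0].
  split; [exact: (strong_cvg_cst hX)|exact: (strong_cvg_cst hX)|exact: cvg_cst|].
  by near=> l.
have [xin previn gamn domn] := IH (fun i hi => r_neq0 i (ltnW hi)).
have rn := r_neq0 n (ltnSn n).
have Bl : \forall l \near \oo, B (gR (st_xi (nz l n))).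
  apply: filterS domn => l hl.
  have reg i : (i < n)%N -> noise_dominated (yd l) (delta l) (nz l i).
    by move=> /hl; exact: noise_dominated_gt.
  by have [] := run_inv (hyd l) reg.
(* Zero momentum occurs only at [n = 0], where both runs start with equal current and previous dual
   iterates. *)
have mn : momentum (run true y 0 n) = 0 -> forall l, momentum (nz l n) = 0.
  case: n r_neq0 {IH xin previn gamn domn rn Bl} => [_ _ l|n r_neq0 m0].
    by rewrite /momentum /= subrr.
  by have := exact_momentum_eq0 (r_neq0 n (leqW (leqnn _))); rewrite m0 eqxx.
have [xi' prev' gam'] :=
  step_cvg xin previn gamn (exact_ball n) Bl rn (exact_gradient_neq0 rn) mn.
split=> //.
have rl := cvg_ipnorm hY (residual_cvg xin (exact_ball n) Bl).
have td : (fun l => tau * delta l) @ \oo --> (0 : R).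
  by rewrite -(mulr0 tau); apply: cvgM => //; exact: cvg_cst.
have r0 : 0 < nY (residual y (run true y 0 n)) by rewrite (ipnorm_gt0 hY).
set r := nY _ in r0 rl.
have r2 : r / 2 < r by lra.
have r2' : 0 < r / 2 by lra.
near=> l => i; rewrite ltnS leq_eqVlt => /predU1P[->|].
  apply: (@lt_trans _ _ (r / 2)).
    by near: l; exact: (cvgr_lt _ td).
  by near: l; exact: (cvgr_gt _ rl).
by move: i; near: l.
Unshelve. all: by end_near. Qed.

(** At a fixed [n] with small exact distance, the noisy distance is eventually small as well; the
    stopping index is not before [n], and monotonicity carries the bound to it. *)
Lemma noisy_bregR_cvg xs (nd : nat -> nat) : F xs = y -> B xs -> edom Rf xs ->
  (fun n => D (st_xi (run true y 0 n)) xs) @ \oo --> (0 : R) ->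
  (forall l, is_stopping_index ipX ipY gR F Lstar eta sigma mu0 mu1 Lc beta adaptive
    xi0 tau (yd l) (delta l) (nd l)) ->
  (fun l => D (st_xi (nz l (nd l))) xs) @ \oo --> (0 : R).
Proof.
move=> Fxs Bxs xsd D0 stop.
have Dge0 xi : 0 <= D xi xs by exact: (bregR_ge0 hX hsigma hproper hconv hgR).
apply: cvg0P_le => // e e0.
have [n [nz_n Dn]] : exists n,
    (forall i, (i < n)%N -> residual y (run true y 0 i) != 0) /\
    D (st_xi (run true y 0 n)) xs < e.
  have [N _ hN] : \forall n \near \oo, D (st_xi (run true y 0 n)) xs < e.
    by apply: (cvgr_lt _ D0).
  have [allnz|] := pselect (forall i, (i < N)%N -> residual y (run true y 0 i) != 0).
    by exists N; split=> //; exact: hN N (leqnn N).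
  move=> /existsNP[i /not_implyP[iN /negP]]; rewrite negbK => ri0.
  have ex : exists i, residual y (run true y 0 i) == 0 by exists i.
  (* Stability is available only up to the first zero residual. There the exact iterate is already
     [xs], since the iterates stay constant afterwards. *)
  case: (ex_minnP ex) => n /eqP rn0 nmin; exists n; split.
    by move=> j; apply: contraTN => /nmin; rewrite -leqNgt.
  suff -> : xs = gR (st_xi (run true y 0 n)) by rewrite (bregR_self hX).
  apply/eqP; rewrite -subr_eq0 -(ipnorm_eq0 hX) -sqrf_eq0 eq_le sqr_ge0 andbT.
  rewrite -(ler_pM2l hsigma) mulr0; apply: (cvgr_to_ge D0).
  exists n => // m /= nm; rewrite -(exact_stationary rn0 nm).
  exact: (bregR_ge hX hsigma hproper hconv hgR).
have [xin _ _ dom] := noisy_cvg nz_n.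
have Dl : \forall l \near \oo, D (st_xi (nz l n)) xs < e.
  have := bregR_continuous hX hsigma hproper hconv hgR (z := xs) xin.
  by move=> /(cvgr_lt _); apply.
near=> l; have [rs _] := stop l.
have nnd : (n <= nd l)%N.
  rewrite leqNgt; apply/negP => ndn.
  have : forall i, (i < n)%N -> tau * delta l < nY (residual (yd l) (nz l i)) by near: l.
  by move=> /(_ _ ndn); rewrite ltNge => /negP; apply; exact: rs.
have regl := stopping_index_dominated (stop l).
apply: le_trans (run_mono (hyd l) Bxs Fxs regl nnd) _.
by apply: ltW; near: l.
Unshelve. all: by end_near. Qed.

End NoisyData.

(** * Identification of the limit under the kernel condition *)

Lemma exact_orthogonal xdag xs n : B xdag -> F xdag = y -> B xs -> F xs = y ->
  (forall x, B x -> forall h, L xdag h = 0 -> L x h = 0) ->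
  ipX (st_xi (run true y 0 n)) (xs - xdag) = ipX xi0 (xs - xdag).
Proof.
move=> Bd Fd Bxs Fxs hker.
have Ld : L xdag (xs - xdag) = 0 by apply: L_eq0 => //; rewrite Fxs.
set h := xs - xdag in Ld *; clearbody h.
(* Momentum and dual iterate are treated jointly; each gradient is orthogonal to [h] because its
   adjoint moves [L x] onto [h]. *)
have [] : ipX (momentum (run true y 0 n)) h = 0 /\
    ipX (st_xi (run true y 0 n)) h = ipX xi0 h; last by [].
elim: n => [|n [IHm IHx]]; first by rewrite /momentum subrr (ip0l hX).
have mS : ipX (momentum (run true y 0 n.+1)) h = 0.
  rewrite [run true y 0 n.+1]/(step true y 0 _) step_momentum.
  rewrite (ipDl hX) (ipNl hX) !(ipZl hX) IHm hadj; last exact: exact_ball.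
  by rewrite (hker _ (exact_ball n) _ Ld) (ip0r hY) !mulr0 subr0.
split=> //; rewrite -IHx; apply/eqP; rewrite -subr_eq0 -(ipNl hX) -(ipDl hX).
by apply/eqP; exact: mS.
Qed.

Lemma kernel_identification xdag xs : F xs = y -> B xs -> edom Rf xs ->
  (fun n => D (st_xi (run true y 0 n)) xs) @ \oo --> (0 : R) ->
  F xdag = y -> edom Rf xdag -> B xdag ->
  (forall z, B z -> edom Rf z -> F z = y -> D xi0 xdag <= D xi0 z) ->
  (forall x, B x -> forall h, L xdag h = 0 -> L x h = 0) ->
  xs = xdag.
Proof.
move=> Fxs Bxs xsd D0 Fd dd Bd hmin hker.
(* By orthogonality the difference of the two distances is the same for [xi0] and [xi_n], so it is
   at most the distance from [xi_n] to [xs], which tends to 0. *)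
have le0 : D xi0 xs <= D xi0 xdag.
  rewrite -subr_le0; apply: (cvgr_to_ge D0); near=> n.
  have := exact_orthogonal n Bd Fd Bxs Fxs hker.
  have := bregR_ge0 hX hsigma hproper hconv hgR (st_xi (run true y 0 n)) dd.
  by rewrite /bregR !(ipE hX); lra.
pose t : R := 2^-1; have t01 : 0 <= t <= 1 by rewrite /t; lra.
pose z := t *: xs + (1 - t) *: xdag.
have zd : z - xdag = t *: (xs - xdag).
  by rewrite /z scalerBl scale1r scalerBr -addrA [xdag - _ - _]addrAC subrr add0r.
have Bz : B z.
  rewrite /hball /= (_ : z - x0 = t *: (xs - x0) + (1 - t) *: (xdag - x0)).
    apply: le_trans (ipnormD hX _ _) _; rewrite !(ipnormZ hX).
    rewrite !ger0_norm /t; [|lra|lra].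
    by move: Bxs Bd; rewrite /hball /=; lra.
  rewrite !scalerBr addrACA -opprD -scalerDl (_ : t + (1 - t) = 1) ?scale1r //.
  by rewrite addrC subrK.
have Ld : L xdag (xs - xdag) = 0 by apply: L_eq0 => //; rewrite Fxs.
(* [z - xdag] lies in the kernel of [L xdag], so the cone condition forces [F z = F xdag]. *)
have Fz : F z = y.
  have /andP[_ e1] := heta.
  have := residual_le_L Bd Bz; rewrite zd.
  have L0 : L xdag 0 = 0 by rewrite -(subrr 0) LB // subrr.
  rewrite -[t *: _]addr0 hlin // Ld scaler0 add0r L0 (ipnorm0 hY) Fd.
  rewrite pmulr_rle0 ?subr_gt0 // => h.
  by apply/eqP; rewrite -subr_eq0 -(ipnorm_eq0 hY) eq_le h ipnorm_ge0.
have [zdom zconv] := strongly_convex_penalty hproper hconv xsd dd t01.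
have := hmin z Bz zdom Fz.
(* The Bregman distance differs from the penalty by an affine function of [z], so it inherits strong
   convexity. *)
have Dz : D xi0 z + sigma * t * (1 - t) * nX (xs - xdag) ^+ 2
    <= t * D xi0 xs + (1 - t) * D xi0 xdag.
  have ipz : ipX xi0 z = t * ipX xi0 xs + (1 - t) * ipX xi0 xdag by rewrite !(ipE hX).
  move: zconv ipz; rewrite -/z; clearbody z; rewrite /bregR !(ipE hX) => zconv ->.
  by move: zconv; lra.
move=> hz.
apply/eqP; rewrite -subr_eq0 -(ipnorm_eq0 hX) -sqrf_eq0 eq_le sqr_ge0 andbT.
by rewrite -(ler_pM2l hsigma) mulr0; move: Dz; rewrite /t; lra.
Unshelve. all: by end_near. Qed.

End HeavyBall.

(** * Passage from the real-valued to the extended Bregman distance *)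

Unset Implicit Arguments.

Theorem mainTheorem9
  (R : realType) (X Y : lmodType R)
  (ipX : X -> X -> R) (ipY : Y -> Y -> R)
  (hX : is_hilbert ipX) (hY : is_hilbert ipY)
  (* the penalty R, here Rf *)
  (Rf : X -> \bar R) (sigma : R)
  (hsigma : 0 < sigma)
  (hproper : proper_fun Rf) (hlsc : lsc_fun ipX Rf)
  (hconv : strongly_convex ipX Rf sigma)
  (gR : X -> X) (hgR : is_grad_conj ipX Rf gR)
  (* the forward operator *)
  (domF : set X) (F : X -> Y) (y : Y)
  (* assumption (b) *)
  (rho : R) (x0 xi0 : X)
  (hrho : 0 < rho) (hxi0 : subdiff ipX Rf x0 xi0)
  (hsubF : hball ipX x0 (2 * rho) `<=` domF)
  (hsol : exists xb, domF xb /\ F xb = y /\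
            (bregman ipX Rf xi0 xb x0 <= (sigma * rho ^+ 2)%:E)%E)
  (* assumption (c) : weak closedness *)
  (hweak : forall (u : nat -> X) (x : X) (v : Y),
      (forall n, domF (u n)) -> weak_cvg ipX u x -> strong_cvg ipY (F \o u) v ->
      domF x /\ F x = v)
  (* assumption (d) *)
  (L : X -> X -> Y) (Lstar : X -> Y -> X) (eta Lc : R)
  (hlin : forall x, hball ipX x0 (2 * rho) x ->
      forall (a : R) (h k : X), L x (a *: h + k) = a *: L x h + L x k)
  (hadj : forall x, hball ipX x0 (2 * rho) x ->
      forall (r : Y) (h : X), ipX (Lstar x r) h = ipY r (L x h))
  (hLcont : forall x, hball ipX x0 (2 * rho) x ->
      forall e : R, 0 < e -> exists d : R, 0 < d /\
        forall x', hball ipX x0 (2 * rho) x' -> ipnorm ipX (x' - x) < d ->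
          forall h, ipnorm ipY (L x' h - L x h) <= e * ipnorm ipX h)
  (heta : 0 <= eta < 1)
  (htcc : forall x xb, hball ipX x0 (2 * rho) x ->
      hball ipX x0 (2 * rho) xb ->
      ipnorm ipY (F x - F xb - L xb (x - xb)) <= eta * ipnorm ipY (F x - F xb))
  (hLc : 0 < Lc)
  (hLbound : forall x, hball ipX x0 (2 * rho) x ->
      forall h, ipnorm ipY (L x h) <= Lc * ipnorm ipX h)
  (* parameters of the algorithms *)
  (tau beta mu0 mu1 : R) (adaptive : bool)
  (htau : 1 < tau) (hbeta : 0 <= beta < 1) (hmu0 : 0 < mu0) (hmu1 : 0 < mu1)
  (hpar : 0 < 1 - (1 + eta) / tau - eta - mu0 / (4 * sigma)) :
  exists xstar : X,
    [/\ domF xstar /\ F xstar = y,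
        hball ipX x0 (2 * rho) xstar /\ edom Rf xstar,
        (* x* is the strong limit of the exact-data iterates (Algorithm 2) *)
        strong_cvg ipX
          (x_exact ipX ipY gR F Lstar eta sigma mu0 mu1 Lc beta adaptive xi0 y) xstar,
        (* convergence of Algorithm 1 as delta -> 0 *)
        (forall (delta : nat -> R) (yd : nat -> Y),
           (forall l, 0 < delta l) -> delta @ \oo --> (0 : R) ->
           (forall l, ipnorm ipY (yd l - y) <= delta l) ->
           (forall l, exists n, is_stopping_index ipX ipY gR F Lstar eta sigma
                                  mu0 mu1 Lc beta adaptive xi0 tau (yd l) (delta l) n) /\
           (forall nd : nat -> nat,
              (forall l, is_stopping_index ipX ipY gR F Lstar eta sigma
                           mu0 mu1 Lc beta adaptive xi0 tau (yd l) (delta l) (nd l)) ->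
              (fun l => bregman ipX Rf
                  (xi_noisy ipX ipY gR F Lstar eta sigma mu0 mu1 Lc beta adaptive xi0
                     (yd l) (delta l) (nd l))
                  xstar
                  (x_noisy ipX ipY gR F Lstar eta sigma mu0 mu1 Lc beta adaptive xi0
                     (yd l) (delta l) (nd l))) @ \oo --> (0 : \bar R) /\
              (fun l => ipnorm ipX
                  (x_noisy ipX ipY gR F Lstar eta sigma mu0 mu1 Lc beta adaptive xi0
                     (yd l) (delta l) (nd l) - xstar)) @ \oo --> (0 : R)))
      & (* identification of the limit under the kernel condition *)
        forall xdag : X,
          domF xdag -> F xdag = y ->
          (forall x, domF x -> F x = y ->
             (bregman ipX Rf xi0 xdag x0 <= bregman ipX Rf xi0 x x0)%E) ->
          (forall x, hball ipX x0 (2 * rho) x ->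
             forall h, L xdag h = 0 -> L x h = 0) ->
          xstar = xdag].
Proof.
have x0E : x0 = gR xi0 by apply: (gR_unique hX hproper hgR).
have [xb [xb_dom [Fxb xb_breg]]] := hsol.
have xbd : edom Rf xb.
  by apply: (edom_bregman hproper hgR (xi := xi0)); rewrite -x0E; exact: xb_breg.
have DE xi z : edom Rf z -> bregman ipX Rf xi z (gR xi) = (@bregR _ _ ipX Rf gR xi z)%:E.
  exact: bregmanE.
have Dxb : @bregR _ _ ipX Rf gR xi0 xb <= sigma * rho ^+ 2.
  by rewrite -lee_fin -DE // -x0E.
have [xs [Fxs Bxs xsd D0]] : exists xs, _ :=
  exact_limit hX hY hsigma hproper hlsc hconv hgR hlin hadj heta htcc hLc hLbound
    (mu1 := mu1) adaptive hmu0 hmu1 hbeta htau hrho hpar x0E xbd Fxb Dxb hsubF hweak.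
have strong (xi : nat -> X) :
    (fun n => @bregR _ _ ipX Rf gR (xi n) xs) @ \oo --> (0 : R) ->
    strong_cvg ipX (fun n => gR (xi n)) xs.
  exact: (strong_cvg_bregR hX hsigma hproper hconv hgR).
exists xs; split=> //.
- by split=> //; exact: hsubF.
- exact: strong.
- move=> delta yd d0 dl hyd; split.
    move=> l; exact: (stopping_index_exists hX hY hsigma hproper hconv hgR hlin hadj
      heta htcc hLc hLbound adaptive hmu0 hmu1 hbeta htau hrho hpar x0E xbd Fxb Dxb).
  move=> nd stop.
  have Dnd : (fun l => @bregR _ _ ipX Rf gR (xi_noisy ipX ipY gR F Lstar eta sigma mu0 mu1
      Lc beta adaptive xi0 (yd l) (delta l) (nd l)) xs) @ \oo --> (0 : R).
    exact: (noisy_bregR_cvg hX hY hsigma hproper hconv hgR hlin hadj hLcont heta htcc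
      hLc hLbound hmu0 hmu1 hbeta htau hrho hpar x0E xbd Fxb Dxb dl hyd Fxs Bxs xsd D0 stop).
  split; last exact: strong.
  under eq_fun do rewrite DE //.
  by apply: cvg_EFin; [exact: nearW | exact: Dnd].
- move=> xdag ddag Fdag hmin hker.
  (* Minimality compares [xdag] with [xs], whose distance is finite. *)
  have dd : edom Rf xdag.
    apply: (edom_bregman hproper hgR (xi := xi0)); rewrite -x0E.
    apply: le_trans (hmin xs _ Fxs) _; first exact: hsubF.
    by rewrite x0E DE.
  have hminR z : hball ipX x0 (2 * rho) z -> edom Rf z -> F z = y ->
      @bregR _ _ ipX Rf gR xi0 xdag <= @bregR _ _ ipX Rf gR xi0 z.
    by move=> Bz zd Fz; rewrite -lee_fin -!DE // -x0E; apply: hmin => //; exact: hsubF.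
  have Dd : @bregR _ _ ipX Rf gR xi0 xdag <= sigma * rho ^+ 2.
    by rewrite -lee_fin -DE // -x0E; apply: le_trans (hmin xb xb_dom Fxb) xb_breg.
  (* Minimality against [xb] gives [xdag] the distance bound of [xb], so [xb_ball] applies with
     [xdag] in its place. *)
  have Bd := xb_ball hX hsigma hproper hconv hgR hrho x0E dd Dd.
  exact: (kernel_identification hX hY hsigma hproper hconv hgR hlin hadj heta htcc
    hLc hLbound hmu0 hmu1 hbeta htau hrho hpar x0E xbd Fxb Dxb Fxs Bxs xsd D0
    Fdag dd Bd hminR hker).
Qed.
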